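(* Let $\beta\in\mathbb{C}$ with $\beta\notin\mathbb{Z}$ and let $\phi(e^{i\theta})=t_\beta(e^{i(\theta-\pi)})$. Then, as $n\to\infty$, $$\det M_n(\phi)\sim n^{-3\beta^2/2+\beta/2}\,(2\pi)^{\beta/2}\,2^{3\beta^2/2}\,G(3/2)^{-1}\,G(3/2-\beta)\,G(1-\beta)\,G(1+\beta).$$ Moreover, $\det M_n(\phi)=0$ if and only if $\beta\in\{3/2,5/2,\dots,n-1/2\}$.
   Context: $\phi_k=\frac1{2\pi}\int_0^{2\pi}\phi(e^{i\theta})e^{-ik\theta}d\theta$ is the $k$-th Fourier coefficient of $\phi$, and $M_n(\phi)=(\phi_{j-k}+\phi_{j+k+1})_{j,k=0}^{n-1}$ is the sum of the $n\times n$ Toeplitz and Hankel matrices of $\phi$. For $\beta\in\mathbb{C}$, $t_\beta(e^{i\theta})=\exp(i\beta(\theta-\pi))$ for $0<\theta<2\pi$; $t_\beta(e^{i(\theta-\pi)})$ is the value of $t_\beta$ at the point $e^{i(\theta-\pi)}=-e^{i\theta}$. $G(\cdot)$ is the Barnes G-function, $G(1+z)=(2\pi)^{z/2}e^{-(z+1)z/2-\gamma_E z^2/2}\prod_{k=1}^\infty\left((1+z/k)^k e^{-z+z^2/(2k)}\right)$, with $\gamma_E$ Euler's constant. $a_n\sim c_n$ means $a_n=c_n(1+o(1))$ as $n\to\infty$ (so if $c_n=0$ for all $n$, then $a_n=0$ for all large $n$).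
   Formalization: The zero set in the last sentence is corrected to {3/2, 5/2, …, n−3/2}: the printed upper end n−1/2 is wrong, since for n=2 and β=3/2 the determinant is (sin(πβ)/π)²(−16/9−48/5), which is not 0. *)

(* Defs.v *)
From HB Require Import structures.
From mathcomp Require Import all_boot all_order all_algebra.
From mathcomp Require Import all_classical all_reals all_analysis.
From mathcomp Require Import complex.

Set Implicit Arguments.
Unset Strict Implicit.
Unset Printing Implicit Defensive.

Import Order.TTheory GRing.Theory Num.Theory numFieldNormedType.Exports.
Local Open Scope classical_set_scope.
Local Open Scope ring_scope.
Local Open Scope complex_scope.

Section Definitions.
Variable R : realType.
Implicit Types (z beta : R[i]) (x theta : R) (phi : R[i] -> R[i]).

Local Notation iC := (0 +i* 1 : R[i]).

Definition cexp z : R[i] :=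
  (expR (complex.Re z))%:C * (cos (complex.Im z) +i* sin (complex.Im z)).

Definition expi theta : R[i] := cexp (iC * theta%:C).

(* x ^ z with the real logarithm of the base, meant for 0 < x *)
Definition cpow x z : R[i] := cexp (z * (ln x)%:C).

(* The argument in [0, 2 pi[ of a point of the unit circle. *)
Definition circle_arg z : R :=
  if 0 <= complex.Im z then acos (complex.Re z)
  else 2 * pi - acos (complex.Re z).

(* Symbols are functions on the unit circle, values elsewhere are irrelevant.
   The value at the jump z = 1, left open by t_beta(e^{i theta}) =
   exp(i beta (theta - pi)) for 0 < theta < 2 pi, is the limit from above; it
   does not affect the Fourier coefficients. *)
Definition t_symbol beta z : R[i] :=
  cexp (iC * beta * (circle_arg z - pi)%:C).

(* phi(e^{i theta}) = t_beta(e^{i (theta - pi)}), where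
   e^{i (theta - pi)} = - e^{i theta} *)
Definition t_shift beta z : R[i] := t_symbol beta (- z).

Definition cintegral (a b : R) (f : R -> R[i]) : R[i] :=
  (\int[lebesgue_measure]_(x in `[a, b]) complex.Re (f x)) +i*
  (\int[lebesgue_measure]_(x in `[a, b]) complex.Im (f x)).

Definition fourier phi (k : int) : R[i] :=
  ((2 * pi)^-1)%:C *
  cintegral 0 (2 * pi) (fun theta => phi (expi theta) * expi (- (k%:~R * theta))).

Definition toeplitz_hankel phi (n : nat) : 'M[R[i]]_n :=
  \matrix_(j < n, k < n)
    (fourier phi (j%:Z - k%:Z) + fourier phi (j%:Z + k%:Z + 1)).

Definition euler_gamma : R :=
  lim ((fun n : nat => \sum_(1 <= k < n.+1) k%:R^-1 - ln n%:R) @ \oo).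

(* [R[i]^o] carries the topology of the modulus. *)
Definition barnes_prod z : R[i] :=
  lim ((fun N : nat => (\prod_(1 <= k < N.+1)
          ((1 + z / k%:R) ^+ k * cexp (- z + z ^+ 2 / (2 * k%:R)))) : R[i]^o)
       @ \oo).

Definition barnesG1p z : R[i] :=
  cpow (2 * pi) (z / 2)
  * cexp (- ((z + 1) * z / 2) - euler_gamma%:C * z ^+ 2 / 2)
  * barnes_prod z.

Definition barnesG z : R[i] := barnesG1p (z - 1).

(* a_n = c_n (1 + o(1)); this forces a_n = 0 for large n wherever c_n = 0. *)
Definition asymp_equiv (a c : nat -> R[i]) : Prop :=
  exists2 e : nat -> R[i]^o, e @ \oo --> (0 : R[i]^o) &
    \forall n \near \oo, a n = c n * (1 + e n).

(* {3/2, 5/2, ..., n - 3/2}, empty for n <= 2. The source prints n - 1/2 as the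
   last element, which is wrong: up to nonzero row and column factors,
   M_n(phi) is the Cauchy matrix with entries
   ((beta - j - 1/2)^2 - (k + 1/2)^2)^-1, so for nonintegral beta its
   determinant vanishes iff 2 beta = i + j + 1 for some 0 <= i < j < n, and
   beta = n - 1/2 would need i = j = n - 1. *)
Definition det_zeros (n : nat) : set R[i] :=
  [set m%:R + 1 / 2 | m in [set m : nat | (1 <= m)%N /\ (m + 2 <= n)%N]].

End Definitions.

(* Main.v *)
Require Import Defs.
From HB Require Import structures.
From mathcomp Require Import all_boot all_order all_algebra.
From mathcomp Require Import all_classical all_reals all_analysis.
From mathcomp Require Import complex.
From mathcomp Require Import measurable_realfun zify ring lra.

Set Implicit Arguments.
Unset Strict Implicit.
Unset Printing Implicit Defensive.

Import Order.TTheory GRing.Theory Num.Theory numFieldNormedType.Exports.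
Local Open Scope classical_set_scope.
Local Open Scope ring_scope.
Local Open Scope complex_scope.

(** The symbol equals exp(i beta theta) for theta in (-pi, pi), hence
    phi_k = (-1)^k sin(pi beta) / (pi (beta - k)) (fourier_t_shift). The entry
    phi_(j-k) + phi_(j+k+1) is then a row factor times a column factor times
    1 / (x_j - y_k) with x_j = (beta - j - 1/2)^2 and y_k = (k + 1/2)^2, and
    one step of elimination in this Cauchy matrix gives the quotient of two
    consecutive determinants D_n in closed form (det_toeplitz_hankel_rec):

      D_(n+1) / D_n = S / prod_(m <= n) (1 - beta^2 / m^2)
                      * prod_(n < m <= 2n) (1 - 2 beta / m) / (1 - beta / m)^2
                      / (1 - beta / (2n + 1)),  S = sin(pi beta) / (pi beta).

    For beta not an integer only a factor 1 - 2 beta / m with m odd can vanish,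
    which describes the zeros (det_toeplitz_hankel_zeros).

    For the asymptotics the product of these quotients is rearranged by
    exponent. For a sequence u let P_N(u) = prod_(m <= N) u_m^m and let
    B_h(u) be the product over l < h of the products of u over ]l, 2l] and
    over ]l, 2l + 1]. Then B_h(u) is P_h(u)^2 / P_2h(u) times a power of the
    dyadic product of u over ]h, 2h] (block_prod_closed). With
    q_j = 1 - beta / j and w_j = 1 - 2 beta / (2j + 1), which are the factors
    1 - 2 beta / m of even and of odd index, one finds for n = 2 (h + 1)

      D_n = (S / prod_(m <= n) (1 - beta^2 / m^2))^n
            * prod_(m <= n) (1 - beta^2 / m^2)^m
            * B_(h+1)(q) / B_n(q) * B_h(w) * prod_(h < j <= 2h) w_j

    (det_toeplitz_hankel_even). Partial products of the Barnes function at 1 + z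
    are P_N(1 + z / m) up to elementary factors (barnes_core_ccvg). The weighted
    product of 1 - beta^2 / m^2 gives G(1 + beta) G(1 - beta), and
    P_N(w) is the quotient of P_N(1 + z / m) at z = 1/2 - beta and z = 1/2,
    which gives G(3/2 - beta) / G(3/2). The two factors B(q) have the same
    constant and leave only powers of 2.

    The powers of dyadic products and the tail of the sine product raised to the
    power n are all instances of one estimate (prod_asymp): if
    u_m = 1 + a/m + b/m^2 + O(m^-3), then the product of u over ]n, N] is
    exp(a ln(N/n) + c (1/n - 1/N)) (1 + O(n^-2)) uniformly in N, where
    c = b - a/2 - a^2/2. An error O(n^-2) survives the power n. That S is the
    limit of prod_(m <= n) (1 - beta^2 / m^2) is Euler's product (sine_product).

    This settles even n; odd n follow because the quotient of consecutive
    determinants tends to 1 (det_ratio_ccvg1). If some w_j is zero, that is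
    beta = j + 1/2 with j >= 1, both sides of the asymptotic relation vanish for
    large n, since G(3/2 - beta) = G(1 - j) = 0. *)

Local Notation normc := Normc.normc.

(** * The modulus and the exponential of complex numbers *)

Section ComplexNorm.
Variable R : realType.
Implicit Types (z w : R[i]) (x y : R).

Lemma normc_ge0 z : 0 <= normc z.
Proof. by case: z => a b; rewrite sqrtr_ge0. Qed.

Lemma normc_eq0 z : (normc z == 0) = (z == 0).
Proof.
apply/eqP/eqP => [/Normc.eq0_normc //|->]; exact: Normc.normc0.
Qed.

Lemma normc_gt0 z : (0 < normc z) = (z != 0).
Proof. by rewrite lt_def normc_ge0 andbT normc_eq0. Qed.

Lemma normcB z w : normc (z - w) = normc (w - z).
Proof. by rewrite -normcN opprB. Qed.

Lemma normcX z n : normc (z ^+ n) = normc z ^+ n.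
Proof.
by elim: n => [|n IH]; rewrite ?expr0 ?Normc.normc1// !exprS Normc.normcM IH.
Qed.

Lemma normc_real x : normc x%:C = `|x|.
Proof. by rewrite /= expr0n /= addr0 sqrtr_sqr. Qed.

Lemma real_complex_nat n : (n%:R : R)%:C = n%:R :> R[i].
Proof. by rewrite rmorph_nat. Qed.

Lemma normc_nat n : normc (n%:R : R[i]) = n%:R.
Proof. by rewrite -real_complex_nat normc_real ger0_norm. Qed.

Lemma normc_prod (I : Type) (r : seq I) (P : pred I) (F : I -> R[i]) :
  normc (\prod_(i <- r | P i) F i) = \prod_(i <- r | P i) normc (F i).
Proof.
by elim/big_rec2 : _ => [|i y1 y2 _ <-]; rewrite ?Normc.normc1 ?Normc.normcM.
Qed.

Lemma normc_Re z : `|complex.Re z| <= normc z.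
Proof.
by case: z => a b /=; rewrite -sqrtr_sqr ler_wsqrtr // lerDl sqr_ge0.
Qed.

Lemma normc_Im z : `|complex.Im z| <= normc z.
Proof.
by case: z => a b /=; rewrite -sqrtr_sqr ler_wsqrtr // lerDr sqr_ge0.
Qed.

Lemma normc_le_ReIm z : normc z <= `|complex.Re z| + `|complex.Im z|.
Proof.
case: z => a b; rewrite [X in X <= _](_ : _ = normc (a%:C + (0 +i* 1) * b%:C)); last first.
  congr normc.
  by apply/eqP; rewrite eq_complex /=; apply/andP; split; apply/eqP; ring.
apply: le_trans (le_normcD _ _) _; rewrite Normc.normcM !normc_real.
have -> : normc (0 +i* 1 : R[i]) = 1.
  by rewrite /= expr0n expr1n add0r sqrtr1.
by rewrite mul1r.
Qed.

Lemma normcDl z w : normc z <= normc (z + w) + normc w.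
Proof. by rewrite -{1}(addrK w z); apply: le_trans (le_normcD _ _) _; rewrite normcN. Qed.

End ComplexNorm.

Section ComplexExp.
Variable R : realType.
Implicit Types (z w : R[i]) (x y : R).

Lemma cexpD z w : cexp (z + w) = cexp z * cexp w.
Proof.
case: z w => a b [c d]; rewrite /cexp /= expRD cosD sinD.
by apply/eqP; rewrite eq_complex /=; apply/andP; split; apply/eqP; ring.
Qed.

Lemma cexp0 : cexp 0 = 1 :> R[i].
Proof.
by rewrite /cexp /= expR0 cos0 sin0 mul1r.
Qed.

Lemma cexp_neq0 z : cexp z != 0.
Proof.
apply/eqP => h; have := cexpD z (- z); rewrite subrr cexp0 h mul0r => /eqP.
by rewrite oner_eq0.
Qed.

Lemma cexpN z : cexp (- z) = (cexp z)^-1.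
Proof.
apply: (mulfI (cexp_neq0 z)); rewrite -cexpD subrr cexp0 divff //; exact: cexp_neq0.
Qed.

Lemma cexpMn z n : cexp (n%:R * z) = cexp z ^+ n.
Proof.
by elim: n => [|n IH]; rewrite ?mul0r ?cexp0 // -natr1 mulrDl mul1r cexpD IH exprSr.
Qed.

Lemma cexp_sum (I : Type) (r : seq I) (P : pred I) (F : I -> R[i]) :
  cexp (\sum_(i <- r | P i) F i) = \prod_(i <- r | P i) cexp (F i).
Proof.
by elim/big_rec2 : _ => [|i y1 y2 _ <-]; rewrite ?cexp0 // cexpD.
Qed.

End ComplexExp.

(** * Taylor estimates *)

(** The mean value theorem turns a bound on the derivative into a bound on the
    function of one order more. Iterated from the trivial bounds on exp, sin and
    cos, it yields the Taylor estimates below. *)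
Lemma derive_bound_step (R : realType) (f f' : R -> R) (K r : R) (k : nat) :
  (forall x : R, `|x| <= r -> is_derive x 1 f (f' x)) -> f 0 = 0 ->
  (forall x, `|x| <= r -> `|f' x| <= K * `|x| ^+ k) ->
  forall x, `|x| <= r -> `|f x| <= K * `|x| ^+ k.+1.
Proof.
move=> df f0 bf x xr.
have K0 : 0 <= K * `|x| ^+ k by apply: le_trans (bf _ xr).
have main a b c : a <= b -> (forall y, y \in `[a, b] -> `|y| <= `|x|) ->
    c \in `[a, b] -> f b - f a = f' c * (b - a) -> b - a = `|x| ->
    `|f b - f a| <= K * `|x| ^+ k.+1.
  move=> ab hab cab -> ->; rewrite normrM normr_id exprSr mulrA.
  apply: ler_wpM2r => //; have cx := hab _ cab.
  apply: le_trans (bf _ (le_trans cx xr)) _.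
  have [x0|x0] := eqVneq x 0; last first.
    apply: ler_wpM2l; last by rewrite lerXn2r ?nnegrE.
    by move: K0; rewrite pmulr_lge0 // exprn_gt0 // normr_gt0.
  by move: cx; rewrite x0 normr0 normr_le0 => /eqP ->; rewrite normr0.
have cont a b : (forall y, y \in `[a, b] -> `|y| <= `|x|) ->
    {within `[a, b], continuous f}.
  move=> hab; apply: derivable_within_continuous => y yab.
  by have [] := df _ (le_trans (hab _ yab) xr).
have [x0|x0] := leP 0 x.
- have hab y : y \in `[0, x] -> `|y| <= `|x|.
    by rewrite in_itv /= => /andP[y0 yx]; rewrite !ger0_norm // (le_trans y0).
  have [c c1 c2] := @MVT_segment _ f f' 0 x x0
     (fun y (hy : y \in `]0, x[) => df y (le_trans (hab y (subset_itv_oo_cc hy)) xr))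
     (cont _ _ hab).
  by have := main _ _ c x0 hab c1 c2; rewrite f0 !subr0; apply; rewrite ger0_norm.
- have hab y : y \in `[x, 0] -> `|y| <= `|x|.
    by rewrite in_itv /= => /andP[y0 yx]; rewrite !ler0_norm ?lerN2 // ltW.
  have [c c1 c2] := @MVT_segment _ f f' x 0 (ltW x0)
     (fun y (hy : y \in `]x, 0[) => df y (le_trans (hab y (subset_itv_oo_cc hy)) xr))
     (cont _ _ hab).
  have := main _ _ c (ltW x0) hab c1 c2; rewrite f0 !sub0r normrN; apply.
  by rewrite ltr0_norm.
Qed.

Section RealTaylor.
Variable R : realType.
Implicit Types x : R.

Lemma expR_taylor2 x : `|x| <= 1 ->
  `|expR x - (1 + x + x ^+ 2 / 2)| <= expR 1 * `|x| ^+ 3.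
Proof.
have e0 (y : R) : `|y| <= 1 -> `|expR y| <= expR 1 * `|y| ^+ 0.
  move=> /ler_normlP[_ h]; rewrite expr0 mulr1 ger0_norm ?expR_ge0 //.
  by rewrite ler_expR.
have e1 := @derive_bound_step R (fun y => expR y - 1) expR _ 1 0%N _ _ e0.
have {}e1 : forall y : R, `|y| <= 1 -> `|expR y - 1| <= expR 1 * `|y| ^+ 1.
  apply: e1 => [y _|]; last by rewrite expR0 subrr.
  by apply: is_derive_eq; rewrite subr0.
have {}e1 := @derive_bound_step R (fun y => expR y - 1 - y) _ _ 1 _ _ _ e1.
have {}e1 : forall y : R, `|y| <= 1 -> `|expR y - 1 - y| <= expR 1 * `|y| ^+ 2.
  apply: e1 => [y _|]; last by rewrite expR0 subrr subr0.
  by apply: is_derive_eq; rewrite subr0.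
have {}e1 := @derive_bound_step R (fun y => expR y - 1 - y - y ^+ 2 / 2) _ _ 1 _ _ _ e1.
move=> hx; rewrite !opprD !addrA; apply: e1 => // [y _|].
  by apply: is_derive_eq; rewrite subr0 /GRing.scale /=; field.
by rewrite expR0 subrr subr0 expr0n /= mul0r subr0.
Qed.

Lemma sin_taylor1 x : `|sin x - x| <= `|x| ^+ 3.
Proof.
have h (r y : R) : `|y| <= r -> `|cos y| <= 1 * `|y| ^+ 0.
  by move=> _; rewrite expr0 mulr1 ler_norml cos_geN1 cos_le1.
have h1 (r : R) : forall y : R, `|y| <= r -> `|sin y| <= 1 * `|y| ^+ 1.
  have := @derive_bound_step R sin _ _ r 0%N _ _ (@h r); apply => //.
  exact: sin0.
have h2 (r : R) : forall y : R, `|y| <= r -> `|1 - cos y| <= 1 * `|y| ^+ 2.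
  have := @derive_bound_step R (fun y => 1 - cos y) _ _ r _ _ _ (h1 r).
  apply=> [y _|]; last by rewrite cos0 subrr.
  by apply: is_derive_eq; ring.
rewrite distrC -[X in _ <= X]mul1r.
have := @derive_bound_step R (fun y => y - sin y) _ _ _ _ _ _ (h2 `|x|).
by apply=> //; rewrite sin0 subrr.
Qed.

Lemma cos_taylor2 x : `|x| <= 1 -> `|cos x - (1 - x ^+ 2 / 2)| <= `|x| ^+ 3.
Proof.
move=> x1.
have h (y : R) : `|y| <= 1 -> `|sin y - y| <= 1 * `|y| ^+ 3.
  by move=> _; rewrite mul1r; exact: sin_taylor1.
rewrite distrC.
have := @derive_bound_step R (fun y => 1 - y ^+ 2 / 2 - cos y) _ _ _ _ _ _ h.
move=> /(_ _ _ x x1) h2; apply: le_trans (h2 _ _) _ => //.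
- by move=> y _; apply: is_derive_eq; rewrite /GRing.scale /=; field.
- by rewrite cos0 expr0n /= mul0r subr0 subrr.
- by rewrite mul1r exprSr ler_piMr // exprn_ge0.
Qed.

Lemma ln1B_taylor2 x : `|x| <= 1 / 2 ->
  `|- ln (1 - x) - (x + x ^+ 2 / 2)| <= 2 * `|x| ^+ 3.
Proof.
move=> hx.
have pos (y : R) : `|y| <= 1 / 2 -> 1 / 2 <= 1 - y by move=> /ler_normlP[_ h]; lra.
have h (y : R) : `|y| <= 1 / 2 -> `|(1 - y)^-1 - 1 - y| <= 2 * `|y| ^+ 2.
  move=> hy; have py := pos _ hy.
  have -> : (1 - y)^-1 - 1 - y = (1 - y)^-1 * y ^+ 2 by field; lra.
  rewrite normrM normrX; apply: ler_wpM2r; first exact: exprn_ge0.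
  rewrite ger0_norm ?invr_ge0; last lra.
  by rewrite invf_ple ?posrE; lra.
have := @derive_bound_step R (fun y => - ln (1 - y) - y - y ^+ 2 / 2) _ _ _ _ _ _ h.
rewrite opprD addrA; apply=> // [y hy|].
  have py := pos _ hy.
  have y0 : 0 < 1 - y by lra.
  have := is_derive1_ln y0 => dl.
  have d1 : is_derive y 1 (fun y : R => 1 - y) (-1).
    by apply: is_derive_eq; rewrite ?sub0r ?add0r ?mul1r ?opprK.
  have d2 := @is_derive1_comp _ (@ln R) (fun y : R => 1 - y) y _ _ dl d1.
  have d3 : is_derive y 1 (fun y : R => ln (1 - y)) ((1 - y)^-1 * -1) by exact: d2.
  by apply: is_derive_eq; rewrite /GRing.scale /=; field; lra.
by rewrite !subr0 ln1 expr0n /= mul0r !subr0 oppr0.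
Qed.

End RealTaylor.

(** The modulus of w dominates its real and imaginary parts, so multiplying the
    real expansions of exp, cos and sin leaves only terms of order three. *)
Lemma cexp_taylor2 (R : realType) : {K : R | 0 <= K & forall w : R[i],
  normc w <= 1 -> normc (cexp w - (1 + w + w ^+ 2 / 2)) <= K * normc w ^+ 3}.
Proof.
exists (10 + 2 * expR 1) => [|[a b] w1]; first by have := expR_ge0 (1 : R); lra.
set n := normc _ in w1 *.
have an : `|a| <= n by exact: (normc_Re (a +i* b)).
have bn : `|b| <= n by exact: (normc_Im (a +i* b)).
have n0 : 0 <= n by exact: normc_ge0.
have a1 : `|a| <= 1 by exact: le_trans w1.
have b1 : `|b| <= 1 by exact: le_trans w1.
have ha := expR_taylor2 a1.
have hs := sin_taylor1 b.
have hc := cos_taylor2 b1.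
have an3 : `|a| ^+ 3 <= n ^+ 3 by rewrite lerXn2r ?nnegrE.
have bn3 : `|b| ^+ 3 <= n ^+ 3 by rewrite lerXn2r ?nnegrE.
have ab2 : `|a * b ^+ 2| <= n ^+ 3.
  rewrite normrM normrX (exprS n 2); apply: ler_pM => //.
  by rewrite lerXn2r ?nnegrE.
have a2b : `|a ^+ 2 * b| <= n ^+ 3.
  rewrite normrM normrX (exprSr n 2); apply: ler_pM => //.
  by rewrite lerXn2r ?nnegrE.
have n30 : 0 <= n ^+ 3 by exact: exprn_ge0.
have A3 : `|1 + a + a ^+ 2 / 2| <= 3.
  have a2 : a ^+ 2 <= 1 by rewrite -real_normK ?num_real // expr_le1.
  have := sqr_ge0 a; move: a1 a2; rewrite !ler_norml => /andP[]; lra.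
have a2b2 : `|a ^+ 2 * b ^+ 2| <= n ^+ 3.
  have -> : a ^+ 2 * b ^+ 2 = (a * b ^+ 2) * a by ring.
  by rewrite normrM -[X in _ <= X]mulr1; apply: ler_pM.
set r := expR a - _ in ha; set s := sin b - b in hs.
set c := cos b - _ in hc; set A := 1 + a + _ in A3 r ha.
have E0 := expR_ge0 (1 : R).
have hr : `|r| <= expR 1 * n ^+ 3.
  by apply: le_trans ha _; apply: ler_wpM2l.
have As : `|A * s| <= 3 * n ^+ 3.
  by rewrite normrM; apply: ler_pM => //; apply: le_trans hs _.
have Ac : `|A * c| <= 3 * n ^+ 3.
  by rewrite normrM; apply: ler_pM => //; apply: le_trans hc _.
have rc : `|r * cos b| <= expR 1 * n ^+ 3.
  rewrite normrM -[X in _ <= X]mulr1; apply: ler_pM => //.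
  by rewrite ler_norml cos_geN1 cos_le1.
have rs : `|r * sin b| <= expR 1 * n ^+ 3.
  rewrite normrM -[X in _ <= X]mulr1; apply: ler_pM => //.
  by rewrite ler_norml sin_geN1 sin_le1.
have -> : cexp (a +i* b) - (1 + a +i* b + (a +i* b) ^+ 2 / 2) =
   (- (a * b ^+ 2) / 2 - (a ^+ 2 * b ^+ 2) / 4 + r * cos b + A * c)
   +i* ((a ^+ 2 * b) / 2 + A * s + r * sin b).
  have -> : (a +i* b) ^+ 2 / 2 = ((a ^+ 2 - b ^+ 2) / 2) +i* (a * b).
    apply: (canLR (mulfK _)); first by rewrite pnatr_eq0.
    rewrite -real_complex_nat; apply/eqP; rewrite eq_complex /=.
    by apply/andP; split; apply/eqP; field.
  rewrite /r /s /c /A /cexp; apply/eqP; rewrite eq_complex /=.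
  by apply/andP; split; apply/eqP; field.
apply: le_trans (normc_le_ReIm _) _ => /=.
set E := expR 1 * n ^+ 3 in rc rs *.
move: ab2 a2b a2b2 As Ac rc rs; rewrite !ler_norml.
move=> /andP[? ?] /andP[? ?] /andP[? ?] /andP[? ?] /andP[? ?] /andP[? ?] /andP[? ?].
have -> : (10 + 2 * expR 1) * n ^+ 3 = (5 * n ^+ 3 + E) + (5 * n ^+ 3 + E).
  by rewrite /E; ring.
by apply: lerD; rewrite ler_norml; apply/andP; split; lra.
Qed.

(** * Limits of complex sequences *)

Section ComplexSequences.
Variable R : realType.
Implicit Types (u v : nat -> R[i]) (l z : R[i]).

Definition ccvg u l := (u : nat -> R[i]^o) @ \oo --> (l : R[i]^o).

Lemma ccvgP u l : ccvg u l <->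
  forall e : R, 0 < e -> \forall n \near \oo, normc (u n - l) < e.
Proof.
split=> [h e e0|h].
  have /cvgrPdist_lt /(_ e%:C) := h; rewrite ltcR => /(_ e0).
  apply: filterS => n; rewrite normcB => hn.
  by move: hn; rewrite -ltcR.
apply/cvgrPdist_lt => e e0.
have er : e = (complex.Re e)%:C by rewrite RRe_real // ger0_real // ltW.
move: e0; rewrite er ltcR => /h; apply: filterS => n; rewrite normcB => hn.
by rewrite -ltcR in hn.
Qed.

Lemma ccvg_cst l : ccvg (fun=> l) l.
Proof. exact: cvg_cst. Qed.

Lemma ccvgM u v l z : ccvg u l -> ccvg v z -> ccvg (fun n => u n * v n) (l * z).
Proof. have h := @cvgM R[i] nat \oo _ u v l z; exact: h. Qed.

Lemma ccvgB u v l z : ccvg u l -> ccvg v z -> ccvg (fun n => u n - v n) (l - z).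
Proof. have h := @cvgB R[i] R[i]^o nat \oo _ u v l z; exact: h. Qed.

Lemma ccvgD u v l z : ccvg u l -> ccvg v z -> ccvg (fun n => u n + v n) (l + z).
Proof. have h := @cvgD R[i] R[i]^o nat \oo _ u v l z; exact: h. Qed.

Lemma ccvgV u l : l != 0 -> ccvg u l -> ccvg (fun n => (u n)^-1) l^-1.
Proof. by move=> l0 h1; apply: (@cvgV R[i]). Qed.

Lemma ccvgX u l k : ccvg u l -> ccvg (fun n => u n ^+ k) (l ^+ k).
Proof.
move=> h; elim: k => [|k IH]; first exact: ccvg_cst.
under [X in ccvg X _]eq_fun do rewrite exprS.
by rewrite exprS; exact: ccvgM.
Qed.

Lemma ccvg_prod (I : eqType) (r : seq I) (u : I -> nat -> R[i]) (l : I -> R[i]) :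
  (forall i, i \in r -> ccvg (u i) (l i)) ->
  ccvg (fun n => \prod_(i <- r) u i n) (\prod_(i <- r) l i).
Proof.
elim: r => [|i r IH] h.
  by under [X in ccvg X _]eq_fun do rewrite big_nil; rewrite big_nil; exact: ccvg_cst.
under [X in ccvg X _]eq_fun do rewrite big_cons.
rewrite big_cons; apply: ccvgM; first by apply: h; rewrite mem_head.
by apply: IH => j jr; apply: h; rewrite inE jr orbT.
Qed.

Lemma ccvg_unique u l z : ccvg u l -> ccvg u z -> l = z.
Proof. by move=> h1 h2; apply: (cvg_unique _ h1 h2). Qed.

Lemma ccvg_near u v l : (\forall n \near \oo, u n = v n) -> ccvg u l -> ccvg v l.
Proof.
move=> h /ccvgP hu; apply/ccvgP => e /hu; apply: filterS2 h => n -> //.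
Qed.

Lemma ccvg_comp (f : nat -> nat) u l : (forall n, (n <= f n)%N) ->
  ccvg u l -> ccvg (fun n => u (f n)) l.
Proof.
move=> hf /ccvgP hu; apply/ccvgP => e /hu [N _ hN].
by exists N => // n /= Nn; apply: hN => /=; apply: leq_trans Nn (hf n).
Qed.

Lemma ccvg_parity u l :
  ccvg (fun n => u n.*2) l -> ccvg (fun n => u n.*2.+1) l -> ccvg u l.
Proof.
move=> /ccvgP h1 /ccvgP h2; apply/ccvgP => e e0.
have [N1 _ h1'] := h1 e e0; have [N2 _ h2'] := h2 e e0.
exists (maxn N1 N2).*2.+1 => // n /= hn.
have hn2 : (maxn N1 N2 <= n./2)%N by rewrite -(doubleK (maxn _ _)) half_leq // ltnW.
have := odd_double_half n; case: odd => /= <-.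
  by rewrite add1n; apply: h2' => /=; apply: leq_trans hn2; exact: leq_maxr.
by rewrite add0n; apply: h1' => /=; apply: leq_trans hn2; exact: leq_maxl.
Qed.

Lemma near_inv_small (e : R) : 0 < e -> \forall n \near \oo, (n%:R^-1 : R) < e.
Proof.
move=> e0; apply: near_inftyS.
exact: (@near_infty_natSinv_lt R (PosNum e0)).
Qed.

Lemma ccvg_bound (K : R) u l :
  (\forall n \near \oo, normc (u n - l) <= K * n%:R^-1) -> ccvg u l.
Proof.
move=> h; apply/ccvgP => e e0.
have K0 : 0 < `|K| + 1 by rewrite ltr_wpDl.
have := near_inv_small (divr_gt0 e0 K0); apply: filterS2 h => n h1 h2.
apply: le_lt_trans h1 _.
apply: (@le_lt_trans _ _ ((`|K| + 1) * n%:R^-1)).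
  by apply: ler_wpM2r; rewrite ?invr_ge0 // (le_trans (ler_norm K)) // lerDl.
by rewrite mulrC -ltr_pdivlMr.
Qed.

Lemma ccvg_normc_le u l (z : R[i]) (M : R) : ccvg u l ->
  (\forall n \near \oo, normc (u n - z) <= M) -> normc (l - z) <= M.
Proof.
move=> /ccvgP hu h; apply/ler_addgt0Pl => e e0.
have [n [h1 h2]] : exists n, normc (u n - l) < e /\ normc (u n - z) <= M.
  have [N _ hN] := filterI (hu e e0) h; exists N; apply: hN => /=; exact: leqnn.
rewrite -(subrKA (u n)); apply: le_trans (le_normcD _ _) _.
by apply: lerD => //; rewrite normcB ltW.
Qed.

Lemma ccvg_real (x : nat -> R) (y : R) :
  x @ \oo --> y -> ccvg (fun n => (x n)%:C) y%:C.
Proof.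
move=> /cvgrPdist_lt h; apply/ccvgP => e /h; apply: filterS => n.
by rewrite -rmorphB normc_real distrC.
Qed.

(** Since exp(u) = exp(u - l) exp(l), continuity is only needed at 0. *)
Lemma ccvg_cexp u l : ccvg u l -> ccvg (fun n => cexp (u n)) (cexp l).
Proof.
move=> hu; pose v n := u n - l.
have hv : ccvg v 0 by rewrite -(subrr l); apply: ccvgB => //; exact: ccvg_cst.
have -> : (fun n => cexp (u n)) = (fun n => cexp (v n) * cexp l).
  by apply/funext => n; rewrite -cexpD subrK.
rewrite -[cexp l in X in ccvg _ X]mul1r.
apply: ccvgM; last exact: ccvg_cst.
have [K K0 hK] := cexp_taylor2 R.
apply/ccvgP => e e0; have /ccvgP hv' := hv.
have d0 : 0 < Num.min 1 (e / (K + 2)).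
  by rewrite lt_min ltr01 divr_gt0 // ltr_wpDl.
have := hv' _ d0; apply: filterS => n; rewrite subr0 lt_min => /andP[v1 v2].
have v0 := normc_ge0 (v n).
have -> : cexp (v n) - 1 = (cexp (v n) - (1 + v n + v n ^+ 2 / 2)) + (v n + v n ^+ 2 / 2).
  by ring.
apply: le_lt_trans (le_normcD _ _) _.
apply: (@le_lt_trans _ _ ((K + 2) * normc (v n))); last first.
  by rewrite mulrC -ltr_pdivlMr // ltr_wpDl.
have vsq : normc (v n) ^+ 2 <= normc (v n).
  by rewrite expr2 ler_piMr // ltW.
have v3 : normc (v n) ^+ 3 <= normc (v n).
  by rewrite exprSr; apply: ler_piMl => //; apply: (le_trans vsq); exact: ltW.
rewrite mulrDl; apply: lerD.
  by apply: le_trans (hK _ (ltW v1)) _; apply: ler_wpM2l.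
apply: le_trans (le_normcD _ _) _.
rewrite Normc.normcM normcX Normc.normcV normc_nat. 
lra.
Qed.

End ComplexSequences.

(** * Products of factors close to 1 *)

Section Products.
Variable R : realType.

Lemma normc_prod_sub1 (I : Type) (r : seq I) (u : I -> R[i]) (d : I -> R) :
  (forall i, normc (u i - 1) <= d i) ->
  normc (\prod_(i <- r) u i - 1) <= expR (\sum_(i <- r) d i) - 1.
Proof.
move=> h; elim: r => [|i r IH].
  by rewrite !big_nil subrr Normc.normc0 expR0 subrr.
rewrite !big_cons; set P := \prod_(_ <- _) _ in IH *; set S := \sum_(_ <- _) _ in IH *.
have -> : u i * P - 1 = (u i - 1) * (P - 1) + (P - 1) + (u i - 1) by ring.
apply: le_trans (le_normcD _ _) _.
have := le_normcD ((u i - 1) * (P - 1)) (P - 1); rewrite Normc.normcM => h1.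
have d0 : 0 <= d i by apply: le_trans (h i); exact: normc_ge0.
have h2 : normc (u i - 1) * normc (P - 1) <= d i * (expR S - 1).
  by apply: ler_pM => //; exact: normc_ge0.
have h3 : 1 + d i <= expR (d i) by exact: expR_ge1Dx.
have h4 : (1 + d i) * expR S <= expR (d i) * expR S.
  by apply: ler_wpM2r => //; exact: expR_ge0.
rewrite expRD; have := h i; nra.
Qed.

Lemma expR_sub1_le (t : R) : t <= 1 / 2 -> 0 <= t -> expR t - 1 <= 2 * t.
Proof.
move=> t1 t0; have h := expR_ge1Dx (- t); rewrite expRN in h.
have e0 := expR_gt0 t.
have : expR t <= (1 - t)^-1.
  by rewrite -[X in X <= _]invrK lef_pV2 ?posrE ?invr_gt0 //; lra.
have : (1 - t)^-1 <= 1 + 2 * t by rewrite -[X in X <= _]mul1r ler_pdivrMr; nra.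
lra.
Qed.

(** A product of factors close to 1 is close to 1, uniformly in their number. *)
Lemma normc_prod_sub1_le (I : eqType) (r : seq I) (u : I -> R[i]) (d : I -> R) :
  (forall i, i \in r -> normc (u i - 1) <= d i) -> \sum_(i <- r) d i <= 1 / 2 ->
  normc (\prod_(i <- r) u i - 1) <= 2 * \sum_(i <- r) d i.
Proof.
move=> h hs.
pose u' i := if i \in r then u i else 1; pose d' i := if i \in r then d i else 0.
have eu : \prod_(i <- r) u i = \prod_(i <- r) u' i.
  by apply: eq_big_seq => i ir; rewrite /u' ir.
have ed : \sum_(i <- r) d i = \sum_(i <- r) d' i.
  by apply: eq_big_seq => i ir; rewrite /d' ir.
have h' i : normc (u' i - 1) <= d' i.
  by rewrite /u' /d'; case: ifP => [/h //|_]; rewrite subrr Normc.normc0.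
have d0 i : 0 <= d' i by apply: le_trans (h' i); exact: normc_ge0.
rewrite eu ed; apply: le_trans (normc_prod_sub1 _ h') _.
by apply: expR_sub1_le; rewrite -?ed // ed sumr_ge0.
Qed.

Lemma normc_expn_sub1_le (z : R[i]) (d : R) (k : nat) :
  normc (z - 1) <= d -> k%:R * d <= 1 / 2 -> normc (z ^+ k - 1) <= 2 * (k%:R * d).
Proof.
move=> h hk.
have := @normc_prod_sub1_le _ (index_iota 0 k) (fun=> z) (fun=> d).
by rewrite prodr_const_nat sumr_const_nat subn0 -(mulr_natl d k); apply.
Qed.

(** Telescoping, as 1/m^2 <= 1/(m - 1) - 1/m. *)
Lemma sum_inv_sqr_le (n N : nat) : (0 < n)%N -> (n <= N)%N ->
  \sum_(n.+1 <= m < N.+1) (m%:R^-1 : R) ^+ 2 <= n%:R^-1.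
Proof.
move=> n0 nN.
suff : \sum_(n.+1 <= m < N.+1) (m%:R^-1 : R) ^+ 2 <= n%:R^-1 - N%:R^-1.
  by move=> /le_trans; apply; rewrite gerBl invr_ge0.
have [k ->] : exists k, N = (n + k)%N by exists (N - n)%N; rewrite subnKC.
elim: k => [|k IH]; first by rewrite addn0 big_geq // subrr.
rewrite addnS big_nat_recr /=; last by rewrite ltnS leq_addr.
have a0 : (0 : R) < (n + k)%:R by rewrite ltr0n addn_gt0 n0.
have a1 : (n + k).+1%:R = (n + k)%:R + 1 :> R by rewrite -natr1.
apply: le_trans (lerD IH (lexx _)) _; rewrite a1.
set a := (n + k)%:R in a0 a1 *; rewrite -subr_ge0.
have -> : n%:R^-1 - (a + 1)^-1 - (n%:R^-1 - a^-1 + (a + 1)^-1 ^+ 2) =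
  a^-1 * (a + 1)^-1 ^+ 2.
  have nn : (n%:R : R) != 0 by rewrite pnatr_eq0 -lt0n.
  by field; rewrite -natrD natr1 !pnatr_eq0 -!lt0n addn_gt0 n0.
by rewrite mulr_ge0 // ?exprn_ge0 ?invr_ge0; lra.
Qed.

Lemma sum_inv_cube_le (n N : nat) : (0 < n)%N -> (n <= N)%N ->
  \sum_(n.+1 <= m < N.+1) (m%:R^-1 : R) ^+ 3 <= n%:R^-1 ^+ 2.
Proof.
move=> n0 nN.
apply: (@le_trans _ _ (\sum_(n.+1 <= m < N.+1) n%:R^-1 * (m%:R^-1 : R) ^+ 2)).
  apply: ler_sum_nat => m /andP[nm _]; rewrite exprS; apply: ler_wpM2r.
    by rewrite exprn_ge0 // invr_ge0.
  by rewrite lef_pV2 ?posrE ?ltr0n ?ler_nat // ?(ltnW nm) // (leq_ltn_trans _ nm).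
rewrite -big_distrr /= expr2; apply: ler_wpM2l; first by rewrite invr_ge0.
exact: sum_inv_sqr_le.
Qed.

End Products.

Section Convergence.
Variable R : realType.

Lemma cauchy_inv_cvg (x : nat -> R) (K : R) :
  (\forall n \near \oo, forall N, (n <= N)%N -> `|x N - x n| <= K * n%:R^-1) ->
  cvg (x @ \oo).
Proof.
move=> h; apply/cauchy_cvgP; apply: cauchy_exP => e e0.
have K0 : 0 < `|K| + 1 by rewrite ltr_wpDl.
have [n0 _ hn0] := filterI h (near_inv_small (divr_gt0 e0 K0)).
have [h1 h2] := hn0 n0 (leqnn n0).
exists (x n0); exists n0 => // N /= nN; rewrite /ball /= distrC.
apply: le_lt_trans (h1 N nN) _.
apply: (@le_lt_trans _ _ ((`|K| + 1) * n0%:R^-1)).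
  by apply: ler_wpM2r; rewrite ?invr_ge0 // (le_trans (ler_norm K)) // lerDl.
by rewrite mulrC -ltr_pdivlMr.
Qed.

Lemma ccvg_cauchy (u : nat -> R[i]) (K : R) :
  (\forall n \near \oo, forall N, (n <= N)%N -> normc (u N - u n) <= K * n%:R^-1) ->
  exists l, ccvg u l.
Proof.
move=> h.
have hRe : cvg ((fun n => complex.Re (u n)) @ \oo).
  apply: (@cauchy_inv_cvg _ K); apply: filterS h => n h N /h.
  by apply: le_trans; rewrite -raddfB; exact: normc_Re.
have hIm : cvg ((fun n => complex.Im (u n)) @ \oo).
  apply: (@cauchy_inv_cvg _ K); apply: filterS h => n h N /h.
  by apply: le_trans; rewrite -raddfB; exact: normc_Im.
set lr := lim _ in hRe; set li := lim _ in hIm.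
exists (lr%:C + 'i%C * li%:C).
rewrite (_ : u = (fun n => (complex.Re (u n))%:C + 'i%C * (complex.Im (u n))%:C)).
  apply: ccvgD; first exact: ccvg_real.
  by apply: ccvgM; [exact: ccvg_cst|exact: ccvg_real].
by apply/funext => n; exact: complexE.
Qed.

Lemma prod_split (F : nat -> R[i]) (n N : nat) : (n <= N)%N ->
  \prod_(1 <= k < N.+1) F k =
  (\prod_(1 <= k < n.+1) F k) * \prod_(n.+1 <= k < N.+1) F k.
Proof. by move=> nN; apply: big_cat_nat. Qed.

(** The second part is the smallness that makes the first bound usable: it keeps
    the product of the tail within distance 1 of 1. *)
Lemma prod_tail_bound (u : nat -> R[i]) (C : R) :
  (\forall k \near \oo, normc (u k - 1) <= C * k%:R^-1 ^+ 2) ->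
  \forall n \near \oo, forall N, (n <= N)%N ->
    normc (\prod_(n.+1 <= k < N.+1) u k - 1) <= 2 * (`|C| * n%:R^-1) /\
    `|C| * n%:R^-1 <= 1 / 2.
Proof.
move=> [M _ hM].
have C0 : 0 < 2 * (`|C| + 1) by rewrite mulr_gt0 // ltr_wpDl.
have [M' _ hM'] := near_inv_small (divr_gt0 ltr01 C0).
exists (maxn M M').+1 => // n /=; rewrite gtn_max => /andP[nM nM'] N nN.
have n0 : (0 < n)%N by exact: leq_ltn_trans nM.
have Cn : `|C| * n%:R^-1 <= 1 / 2.
  have := hM' n (ltnW nM'); rewrite ltr_pdivlMr // => h.
  have : 0 <= n%:R^-1 :> R by rewrite invr_ge0.
  set t := n%:R^-1 in h *; set c := `|C| in h C0 *; nra.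
split=> //.
have hs : \sum_(n.+1 <= k < N.+1) `|C| * (k%:R^-1 : R) ^+ 2 <= `|C| * n%:R^-1.
  rewrite -big_distrr /=; apply: ler_wpM2l => //; exact: sum_inv_sqr_le.
apply: le_trans (@normc_prod_sub1_le _ _ _ u (fun k => `|C| * k%:R^-1 ^+ 2) _ _) _.
- move=> k; rewrite mem_index_iota => /andP[nk _].
  have Mk : (M <= k)%N by exact: leq_trans (ltnW nM) (ltnW nk).
  apply: le_trans (hM k Mk) _; apply: ler_wpM2r; last exact: ler_norm.
  by rewrite exprn_ge0 // invr_ge0.
- exact: le_trans hs Cn.
- by apply: ler_wpM2l.
Qed.

(** The partial products are bounded, as the tail stays close to 1; they are
    then Cauchy with rate 1/n. *)
Lemma prod_ccvg (u : nat -> R[i]) (C : R) :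
  (\forall k \near \oo, normc (u k - 1) <= C * k%:R^-1 ^+ 2) ->
  exists l, ccvg (fun N => \prod_(1 <= k < N.+1) u k) l.
Proof.
move=> /prod_tail_bound [M _ hM].
set p := fun N => \prod_(1 <= k < N.+1) u k.
have pb N : (M <= N)%N -> normc (p N) <= normc (p M) * 2.
  move=> MN; rewrite /p (prod_split _ MN) Normc.normcM; apply: ler_wpM2l.
    exact: normc_ge0.
  have [h1 h2] := hM M (leqnn M) N MN.
  have := normcDl (\prod_(M.+1 <= k < N.+1) u k) (- 1).
  rewrite normcN Normc.normc1; lra.
apply: (@ccvg_cauchy _ (normc (p M) * 2 * (2 * `|C|))).
exists M => // n /= Mn N nN; rewrite /p (prod_split _ nN) -/(p n).
rewrite -{2}[p n]mulr1 -mulrBr Normc.normcM -!mulrA mulrA.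
have [h1 h2] := hM n Mn N nN.
by apply: ler_pM => //; [exact: normc_ge0|exact: normc_ge0|exact: pb].
Qed.

(** Nonvanishing is obtained by applying the convergence criterion to the
    inverses as well: the two limits are inverse to each other. *)
Lemma prod_ccvg_neq0 (u : nat -> R[i]) (C : R) (l : R[i]) :
  (\forall k \near \oo, normc (u k - 1) <= C * k%:R^-1 ^+ 2) ->
  (forall k, (0 < k)%N -> u k != 0) ->
  ccvg (fun N => \prod_(1 <= k < N.+1) u k) l -> l != 0.
Proof.
move=> hu u0 hl.
have hV : \forall k \near \oo, normc ((u k)^-1 - 1) <= (2 * C) * k%:R^-1 ^+ 2.
  have := prod_tail_bound hu => -[M _ hM].
  have [M2 _ hM2] := hu.
  exists (maxn M M2).+1 => // k /=; rewrite gtn_max => /andP[Mk Mk2].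
  have k0 : (0 < k)%N by exact: leq_ltn_trans Mk.
  have [_ h2] := hM k (ltnW Mk) k (leqnn k).
  have h3 := hM2 k (ltnW Mk2).
  have k1 : (k%:R^-1 : R) <= 1 by rewrite invf_le1 ?ltr0n // ler1n.
  have k2 : 0 <= (k%:R^-1 : R) by rewrite invr_ge0.
  have u12 : normc (u k - 1) <= 1 / 2.
    apply: le_trans h3 _; apply: le_trans h2; apply: (@le_trans _ _ (`|C| * k%:R^-1 ^+ 2)).
      by apply: ler_wpM2r; [rewrite exprn_ge0|rewrite ler_norm].
    by apply: ler_wpM2l => //; rewrite expr2 ler_piMr.
  have uk : 1 / 2 <= normc (u k).
    have := normcDl 1 (u k - 1); rewrite Normc.normc1 (addrC 1) subrK; lra.
  have -> : (u k)^-1 - 1 = (1 - u k) / u k by rewrite mulrBl mul1r divff // u0.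
  rewrite Normc.normcM Normc.normcV ler_pdivrMr; last lra.
  rewrite normcB; have := normc_ge0 (u k - 1).
  set a := normc (u k - 1) in h3 *; set b := C * _ in h3 *; set c := normc (u k) in uk *.
  by rewrite -mulrA -/b => a0; nra.
have [l' hl'] := prod_ccvg hV.
have := ccvgM hl hl'.
have -> : (fun n => (\prod_(1 <= k < n.+1) u k) * \prod_(1 <= k < n.+1) (u k)^-1) = (fun=> 1).
  apply/funext => n; rewrite -big_split /= big_nat big1 // => k /andP[k0 _].
  by rewrite divff // u0.
move=> /(ccvg_unique (@ccvg_cst R 1)) h; apply/eqP => l0.
by move: h; rewrite l0 mul0r => /eqP; rewrite oner_eq0.
Qed.

End Convergence.

(** * Second order expansions in 1/m *)

Section Expansion.
Variable R : realType.
Implicit Types (u v d : nat -> R[i]) (a b c z : R[i]).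

Definition Ocube d := exists K : R, \forall m \near \oo, normc (d m) <= K * m%:R^-1 ^+ 3.

Local Notation t m := (m%:R^-1 : R[i]).

Lemma normc_inv_nat m : normc (t m) = m%:R^-1.
Proof. by rewrite Normc.normcV normc_nat. Qed.

Lemma OcubeD d d' : Ocube d -> Ocube d' -> Ocube (fun m => d m + d' m).
Proof.
move=> [K h] [K' h']; exists (K + K'); apply: filterS2 h h' => m h h'.
by apply: le_trans (le_normcD _ _) _; rewrite mulrDl lerD.
Qed.

Lemma OcubeM d v (B : R) : Ocube d -> (\forall m \near \oo, normc (v m) <= B) ->
  Ocube (fun m => d m * v m).
Proof.
move=> [K h] h'; exists (K * B); apply: filterS2 h h' => m h h'.
rewrite Normc.normcM mulrAC; apply: ler_pM => //; exact: normc_ge0.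
Qed.

Lemma near_inv_le1 : \forall m \near \oo, 0 < (m%:R^-1 : R) <= 1.
Proof.
exists 1%N => // m /= m1.
by rewrite invr_gt0 ltr0n m1 invf_le1 ?ler1n ?ltr0n.
Qed.

Lemma poly_bounded a b : exists B : R,
  \forall m \near \oo, normc (a + b * t m) <= B.
Proof.
exists (normc a + normc b); apply: filterS near_inv_le1 => m /andP[_ h].
apply: le_trans (le_normcD _ _) _; apply: lerD => //.
by rewrite Normc.normcM normc_inv_nat ler_piMr // normc_ge0.
Qed.

Lemma Ocube_poly a b : Ocube (fun m => t m ^+ 3 * (a + b * t m)).
Proof.
have [B hB] := poly_bounded a b; apply: OcubeM hB.
exists 1; apply: nearW => m; by rewrite normcX normc_inv_nat mul1r.
Qed.

Lemma Ocube_eq d d' : (\forall m \near \oo, d m = d' m) -> Ocube d -> Ocube d'.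
Proof. by move=> e [K h]; exists K; apply: filterS2 e h => m <-. Qed.

Definition expand2 u a b :=
  Ocube (fun m => u m - (1 + a * t m + b * t m ^+ 2)).

Lemma expand2_bounded u a b : expand2 u a b ->
  exists B : R, \forall m \near \oo, normc (u m) <= B.
Proof.
move=> [K hK]; exists (`|K| + (1 + normc a + normc b)).
apply: filterS2 near_inv_le1 hK => m /andP[t0 t1] h.
have -> : u m = (u m - (1 + a * t m + b * t m ^+ 2)) + (1 + a * t m + b * t m ^+ 2).
  by rewrite subrK.
apply: le_trans (le_normcD _ _) _; apply: lerD.
  apply: le_trans h _; apply: le_trans (ler_norm _) _; rewrite normrM.
  by apply: ler_piMr => //; rewrite ger0_norm ?exprn_ge0 ?(ltW t0) // exprn_ile1 ?(ltW t0).
apply: le_trans (le_normcD _ _) _; apply: lerD.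
  apply: le_trans (le_normcD _ _) _; rewrite Normc.normc1 lerD2l.
  by rewrite Normc.normcM normc_inv_nat ler_piMr // normc_ge0.
rewrite Normc.normcM normcX normc_inv_nat ler_piMr ?normc_ge0 // exprn_ile1 // ltW.
Qed.

Lemma expand2M u v a b a' b' : expand2 u a b -> expand2 v a' b' ->
  expand2 (fun m => u m * v m) (a + a') (b + b' + a * a').
Proof.
move=> hu hv; have [B hB] := expand2_bounded hv.
have hU : expand2 (fun m => 1 + a * t m + b * t m ^+ 2) a b.
  by exists 0; apply: nearW => m; rewrite subrr Normc.normc0 mul0r.
have [B' hB'] := expand2_bounded hU.
have h1 := OcubeM hu hB; have h2 := OcubeM hv hB'.
apply: Ocube_eq (OcubeD (OcubeD h1 h2) (Ocube_poly (a * b' + b * a') (b * b'))).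
by apply: nearW => m /=; ring.
Qed.

Lemma expand2_cexp w a b :
  Ocube (fun m => w m - (a * t m + b * t m ^+ 2)) ->
  expand2 (fun m => cexp (w m)) a (b + a ^+ 2 / 2).
Proof.
move=> hw; have [K hK] := hw.
have [E E0 hE] := cexp_taylor2 R.
pose L := normc a + normc b + `|K|.
have L0 : 0 <= L by rewrite !addr_ge0 // normc_ge0.
have wL : \forall m \near \oo, normc (w m) <= L * m%:R^-1.
  apply: filterS2 near_inv_le1 hK => m /andP[t0 t1] h.
  have -> : w m = (a * t m + b * t m ^+ 2) + (w m - (a * t m + b * t m ^+ 2)).
    by rewrite addrC subrK.
  apply: le_trans (le_normcD _ _) _; rewrite /L !mulrDl; apply: lerD.
    apply: le_trans (le_normcD _ _) _; rewrite (Normc.normcM a) (Normc.normcM b) normcX normc_inv_nat.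
    by apply: lerD => //; apply: ler_wpM2l; rewrite ?normc_ge0 // expr2 ler_piMr // ltW.
  apply: le_trans h _; apply: (@le_trans _ _ (`|K| * m%:R^-1 ^+ 3)).
    by apply: ler_wpM2r; rewrite ?ler_norm // exprn_ge0 // ltW.
  apply: ler_wpM2l => //; rewrite exprS ler_piMr ?exprn_ile1 // ltW //.
have L1 : 0 < L + 1 by rewrite ltr_wpDl.
have w1 : \forall m \near \oo, normc (w m) <= 1.
  apply: filterS2 wL (near_inv_small (divr_gt0 ltr01 L1)) => m h1 h2.
  apply: le_trans h1 _.
  have t0 : 0 <= m%:R^-1 :> R by rewrite invr_ge0.
  move: h2; rewrite ltr_pdivlMr // => h2; nra.
have h1 : Ocube (fun m => cexp (w m) - (1 + w m + w m ^+ 2 / 2)).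
  exists (E * L ^+ 3); apply: filterS2 w1 wL => m h1 h2.
  apply: le_trans (hE _ h1) _; rewrite -mulrA -exprMn; apply: ler_wpM2l => //.
  by rewrite lerXn2r ?nnegrE ?normc_ge0 // (le_trans (normc_ge0 _) h2).
have h2 : exists B : R, \forall m \near \oo,
    normc (1 + (w m + (a * t m + b * t m ^+ 2)) / 2) <= B.
  exists (1 + (1 + (normc a + normc b))).
  apply: filterS2 w1 near_inv_le1 => m w1 /andP[t0 t1].
  apply: le_trans (le_normcD _ _) _; rewrite Normc.normc1 lerD2l.
  rewrite Normc.normcM Normc.normcV normc_nat.
  set x := w m + _.
  suff : normc x <= 1 + (normc a + normc b) by have := normc_ge0 x; lra.
  apply: le_trans (le_normcD _ _) _; apply: lerD => //.
  apply: le_trans (le_normcD _ _) _; rewrite (Normc.normcM a) (Normc.normcM b) normcX normc_inv_nat.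
  by apply: lerD; rewrite ler_piMr ?normc_ge0 ?exprn_ile1 // ltW.
have [B hB] := h2.
have h3 := OcubeM hw hB.
apply: Ocube_eq (OcubeD (OcubeD h1 h3) (Ocube_poly (a * b) (b ^+ 2 / 2))).
apply: nearW => m /=; move: (t m) (w m) => s x; by field.
Qed.

End Expansion.

(** * Products over long ranges of indices *)

Section ProductAsymptotics.
Variable R : realType.
Implicit Types (u v d : nat -> R[i]) (a b c z : R[i]).
Local Notation t m := (m%:R^-1 : R[i]).

Lemma ln_step_expand : Ocube (fun m =>
  (ln m%:R - ln m.-1%:R : R)%:C - (t m + 2^-1 * t m ^+ 2)).
Proof.
exists 2; exists 2%N => // -[|m] //= m2.
have m0 : (0 : R) < m%:R by rewrite ltr0n.
have m10 : (0 : R) < m.+1%:R by rewrite ltr0n.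
set x := (m.+1%:R^-1 : R).
have hx : `|x| <= 1 / 2.
  rewrite ger0_norm ?invr_ge0 // mul1r lef_pV2 ?posrE //.
  by rewrite -[2]/(2%:R) ler_nat.
have -> : ln m.+1%:R - ln m%:R = - ln (1 - x).
  have -> : 1 - x = m%:R / m.+1%:R.
    have -> : (m%:R : R) = m.+1%:R - 1 by rewrite -natr1 addrK.
    by rewrite mulrBl divff ?gt_eqF // mul1r.
  by rewrite ln_div ?posrE // opprB.
have -> : t m.+1 = x%:C by rewrite /x fmorphV rmorph_nat.
have -> : (- ln (1 - x))%:C - (x%:C + 2^-1 * x%:C ^+ 2) =
    (- ln (1 - x) - (x + x ^+ 2 / 2))%:C.
  by clearbody x; rewrite (mulrC 2^-1) rmorphB rmorphD rmorphM fmorphV rmorph_nat rmorphXn.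
rewrite normc_real; apply: le_trans (ln1B_taylor2 hx) _.
by rewrite ger0_norm // invr_ge0.
Qed.

Lemma inv_step_expand : Ocube (fun m => t m.-1 - t m - t m ^+ 2 : R[i]).
Proof.
exists 2; exists 2%N => // -[|m] //= m2.
have m0 : (0 : R) < m%:R by rewrite ltr0n.
have mc0 : (m%:R : R[i]) != 0 by rewrite pnatr_eq0 -lt0n.
have mc1 : (m%:R + 1 : R[i]) != 0 by rewrite natr1 pnatr_eq0.
have -> : t m - t m.+1 - t m.+1 ^+ 2 = t m.+1 ^+ 2 * t m.
  by rewrite -natr1; field; rewrite mc0 mc1.
rewrite Normc.normcM normcX !normc_inv_nat.
have -> : 2 * m.+1%:R^-1 ^+ 3 = m.+1%:R^-1 ^+ 2 * (2 * m.+1%:R^-1) :> R by ring.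
apply: ler_wpM2l; first by rewrite exprn_ge0 // invr_ge0.
rewrite ler_pdivlMr ?ltr0n // mulrC ler_pdivrMr // -natr1.
have : (1 : R) <= m%:R by rewrite ler1n.
lra.
Qed.

(** The coefficient c for which exp(a (ln m - ln(m - 1)) + c (1/(m - 1) - 1/m))
    equals 1 + a/m + b/m^2 + O(m^-3). *)
Definition prod_exponent a b := b - a / 2 - a ^+ 2 / 2.

(** The comparison exponential is chosen telescoping, so that each quotient is
    1 + O(m^-3) and the total error is the tail of a convergent series. *)
Lemma prod_asymp u a b : expand2 u a b ->
  exists K : R, \forall n \near \oo, forall N, (n <= N)%N ->
    normc (\prod_(n.+1 <= m < N.+1) u m *
      cexp (- (a * (ln N%:R - ln n%:R)%:C + prod_exponent a b * (t n - t N))) - 1)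
    <= K * n%:R^-1 ^+ 2.
Proof.
move=> hu; set c := prod_exponent a b.
pose w m : R[i] := - (a * (ln m%:R - ln m.-1%:R)%:C + c * (t m.-1 - t m)).
have hw : Ocube (fun m => w m - ((- a) * t m + (- (a / 2 + c)) * t m ^+ 2)).
  have h1 : Ocube (fun m => ((ln m%:R - ln m.-1%:R : R)%:C - (t m + 2^-1 * t m ^+ 2)) * - a).
    by apply: (OcubeM ln_step_expand (B := normc (- a))); exact: nearW.
  have h2 : Ocube (fun m => (t m.-1 - t m - t m ^+ 2) * - c).
    by apply: (OcubeM inv_step_expand (B := normc (- c))); exact: nearW.
  apply: Ocube_eq (OcubeD h1 h2); apply: nearW => m; rewrite /w.
  move: (t m) (t m.-1) (_%:C) => x y l; by field.
have [K hK] := expand2M hu (expand2_cexp hw).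
have {}hK : \forall m \near \oo, normc (u m * cexp (w m) - 1) <= K * m%:R^-1 ^+ 3.
  apply: filterS hK => m; set X := (X in normc X <= _ -> _).
  suff -> : X = u m * cexp (w m) - 1 by [].
  rewrite /X /c /prod_exponent; move: (t m) (u m * _) => x y; by field.
have [M _ hM] := hK.
have K0 : 0 < 2 * (`|K| + 1) by rewrite mulr_gt0 // ltr_wpDl.
have [M' _ hM'] := near_inv_small (divr_gt0 ltr01 K0).
exists (2 * `|K|); exists (maxn M M').+1 => // n /=; rewrite gtn_max => /andP[nM nM'] N nN.
have n0 : (0 < n)%N by exact: leq_ltn_trans nM.
have tn : 0 < (n%:R^-1 : R) <= 1 by rewrite invr_gt0 ltr0n n0 invf_le1 ?ler1n ?ltr0n.
have -> : \prod_(n.+1 <= m < N.+1) u m *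
      cexp (- (a * (ln N%:R - ln n%:R)%:C + c * (t n - t N))) =
      \prod_(n.+1 <= m < N.+1) (u m * cexp (w m)).
  rewrite big_split /= -cexp_sum; congr (_ * cexp _).
  rewrite sumrN big_split /= -!big_distrr /=; congr (- (a * _ + c * _)).
    rewrite -(rmorph_sum (real_complex R)) /=; congr (_%:C).
    by rewrite big_add1 /= telescope_sumr.
  rewrite big_add1 /= -[LHS]opprB -(telescope_sumr (fun m => t m) nN) -sumrN.
  by apply: eq_bigr => m _; rewrite opprB.
have hs : \sum_(n.+1 <= k < N.+1) `|K| * (k%:R^-1 : R) ^+ 3 <= `|K| * n%:R^-1 ^+ 2.
  rewrite -big_distrr /=; apply: ler_wpM2l => //; exact: sum_inv_cube_le.
apply: le_trans (@normc_prod_sub1_le _ _ _ _ (fun k => `|K| * k%:R^-1 ^+ 3) _ _) _.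
- move=> k; rewrite mem_index_iota => /andP[nk _].
  have Mk : (M <= k)%N by exact: leq_trans (ltnW nM) (ltnW nk).
  apply: le_trans (hM k Mk) _; apply: ler_wpM2r; last exact: ler_norm.
  by rewrite exprn_ge0 // invr_ge0.
- apply: le_trans hs _.
  have := hM' n (ltnW nM'); rewrite ltr_pdivlMr // => h.
  move: tn; set s := n%:R^-1 in h * => /andP[s0 s1].
  have : `|K| * s ^+ 2 <= `|K| * s by rewrite ler_wpM2l // expr2 ler_piMr // ltW.
  move: h; have : 0 <= `|K| by []. 
  set k := `|K| => k0 h h2; lra.
- by rewrite -mulrA; apply: ler_wpM2l.
Qed.

End ProductAsymptotics.

Lemma prod_nat_neq0 (F : fieldType) (u : nat -> F) n :
  (forall k, (0 < k)%N -> u k != 0) -> \prod_(1 <= k < n.+1) u k != 0.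
Proof.
move=> u0; rewrite prodf_seq_neq0; apply/allP => k.
by rewrite mem_index_iota => /andP[/u0].
Qed.

Section DoublingLimits.
Variable R : realType.
Implicit Types (u v d : nat -> R[i]) (a b c z : R[i]).
Local Notation t m := (m%:R^-1 : R[i]).
Local Notation ln2 := ((ln 2 : R)%:C).

Lemma expn_ccvg1 (x : nat -> R[i]) (K : R) :
  (\forall n \near \oo, normc (x n - 1) <= K * n%:R^-1 ^+ 2) ->
  ccvg (fun n => x n ^+ n) 1.
Proof.
move=> h.
have K0 : 0 < 2 * (`|K| + 1) by rewrite mulr_gt0 // ltr_wpDl.
apply: (@ccvg_bound _ (2 * `|K|)); near=> n.
have n0 : (0 : R) < n%:R by rewrite ltr0n; near: n; exact: nbhs_infty_gt.
have h1 : normc (x n - 1) <= `|K| * n%:R^-1 ^+ 2.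
  apply: (@le_trans _ _ (K * n%:R^-1 ^+ 2)); first by near: n.
  by apply: ler_wpM2r; rewrite ?ler_norm // exprn_ge0 // invr_ge0.
have h2 : n%:R^-1 < 1 / (2 * (`|K| + 1)).
  by near: n; apply: near_inv_small; rewrite divr_gt0.
have e : n%:R * (`|K| * n%:R^-1 ^+ 2) = `|K| * n%:R^-1 :> R.
  by field; rewrite gt_eqF.
rewrite -mulrA -e; apply: normc_expn_sub1_le => //; rewrite e.
move: h2; rewrite ltr_pdivlMr //; have : 0 < (n%:R^-1 : R) by rewrite invr_gt0.
by move: (n%:R^-1) (`|K|) => s k; nra.
Unshelve. all: by end_near. Qed.

Lemma ln_double n : (0 < n)%N -> ln (n.*2)%:R - ln n%:R = ln 2 :> R.
Proof.
move=> n0; rewrite -muln2 natrM lnM ?posrE ?ltr0n //.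
by rewrite addrAC subrr add0r.
Qed.

Lemma inv_double n : (0 < n)%N -> t n - t n.*2 = (n.*2%:R)^-1.
Proof.
move=> n0; rewrite -muln2 natrM; field.
by rewrite pnatr_eq0 -lt0n.
Qed.

Definition dyadic_prod u n := \prod_(n.+1 <= m < n.*2.+1) u m.

Lemma dyadic_prod_asymp u a b : expand2 u a b -> exists K : R,
  \forall n \near \oo,
  normc (dyadic_prod u n * cexp (- (a * ln2 + prod_exponent a b * t n.*2)) - 1) <=
    K * n%:R^-1 ^+ 2.
Proof.
move=> /prod_asymp [K hK]; exists K; near=> n.
have n0 : (0 < n)%N by near: n; exact: nbhs_infty_gt.
have : forall N, (n <= N)%N ->
    normc (\prod_(n.+1 <= m < N.+1) u m *
      cexp (- (a * (ln N%:R - ln n%:R)%:C + prod_exponent a b * (t n - t N))) - 1)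
    <= K * n%:R^-1 ^+ 2 by near: n.
move=> /(_ n.*2); rewrite ln_double // inv_double // /dyadic_prod; apply.
by rewrite -addnn leq_addr.
Unshelve. all: by end_near. Qed.

Lemma ccvg_inv_nat : ccvg (fun n => t n) 0.
Proof.
apply: (@ccvg_bound _ 1); apply: nearW => n.
by rewrite subr0 normc_inv_nat mul1r.
Qed.

Lemma dyadic_prod_ccvg u a b : expand2 u a b -> ccvg (dyadic_prod u) (cexp (a * ln2)).
Proof.
move=> /dyadic_prod_asymp [K hK].
have h1 : ccvg (fun n => dyadic_prod u n * cexp (- (a * ln2 + prod_exponent a b * t n.*2))) 1.
  apply: (@ccvg_bound _ `|K|); near=> n.
  apply: (@le_trans _ _ (K * n%:R^-1 ^+ 2)); first by near: n.
  have /andP[s0 s1] : 0 < (n%:R^-1 : R) <= 1 by near: n; exact: near_inv_le1.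
  move: s0 s1; move: n%:R^-1 => s s0 s1.
  apply: (@le_trans _ _ (`|K| * s ^+ 2)).
    by apply: ler_wpM2r; rewrite ?ler_norm // exprn_ge0 // ltW.
  by apply: ler_wpM2l => //; rewrite expr2 ler_piMr // ltW.
have h2 : ccvg (fun n => cexp (a * ln2 + prod_exponent a b * t n.*2)) (cexp (a * ln2 + prod_exponent a b * 0)).
  apply: ccvg_cexp; apply: ccvgD; first exact: ccvg_cst.
  apply: ccvgM; first exact: ccvg_cst.
  apply: (@ccvg_comp _ double (fun n => t n)); last exact: ccvg_inv_nat.
  by move=> n; rewrite -addnn leq_addr.
have := ccvgM h1 h2; rewrite mulr0 addr0 mul1r; apply: ccvg_near.
by apply: nearW => n; rewrite cexpN mulfVK // cexp_neq0.
Unshelve. all: by end_near. Qed.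

Lemma dyadic_prod_pow_ccvg u a b : expand2 u a b ->
  ccvg (fun n => dyadic_prod u n ^+ n.*2 * cexp (- (n.*2%:R * (a * ln2))))
    (cexp (prod_exponent a b)).
Proof.
move=> /dyadic_prod_asymp [K hK].
have := @ccvgX _ _ _ 2 (expn_ccvg1 hK); rewrite expr1n.
move=> /(fun h => ccvgM h (@ccvg_cst R (cexp (prod_exponent a b)))); rewrite mul1r.
apply: ccvg_near; near=> n.
have n0 : (n.*2%:R : R[i]) != 0.
  rewrite pnatr_eq0 double_eq0 -lt0n; near: n; exact: nbhs_infty_gt.
rewrite -exprM muln2 exprMn -cexpMn mulrN mulrDr (mulrCA _ (prod_exponent _ _)).
rewrite divff // mulr1 opprD cexpD (cexpN (prod_exponent _ _)) -(mulrA (dyadic_prod u n ^+ _)) mulfVK //.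
exact: cexp_neq0.
Unshelve. all: by end_near. Qed.

Lemma tail_pow_ccvg u b l : expand2 u 0 b -> (forall k, (0 < k)%N -> u k != 0) ->
  ccvg (fun N => \prod_(1 <= k < N.+1) u k) l ->
  ccvg (fun n => (l / \prod_(1 <= k < n.+1) u k) ^+ n) (cexp b).
Proof.
move=> hu u0 hl; have [K hK] := prod_asymp hu.
have c_b : prod_exponent 0 b = b by rewrite /prod_exponent mul0r expr0n mul0r !subr0.
have : \forall n \near \oo,
  normc (l / (\prod_(1 <= k < n.+1) u k) * cexp (- (b * t n)) - 1) <= K * n%:R^-1 ^+ 2.
  apply: filterS hK => n hn.
  have p0 := prod_nat_neq0 n u0.
  apply: (@ccvg_normc_le _ (fun N => (\prod_(1 <= k < N.+1) u k) / (\prod_(1 <= k < n.+1) u k) * cexp (- (b * (t n - t N))))).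
    rewrite -[X in cexp (- (b * X))]subr0.
    apply: ccvgM; first by apply: ccvgM; [exact: hl|exact: ccvg_cst].
    apply: ccvg_cexp; rewrite -mulNr; under [X in ccvg X _]eq_fun do rewrite -mulNr.
    apply: ccvgM; first exact: ccvg_cst.
    by apply: ccvgB; [exact: ccvg_cst|exact: ccvg_inv_nat].
  exists n => // N /= nN; have := hn N nN.
  by rewrite (prod_split _ nN) (mulrC (\prod_(1 <= _ < _) _)) mulfK // mul0r add0r c_b.
move=> /expn_ccvg1 /(fun h => ccvgM h (@ccvg_cst R (cexp b))); rewrite mul1r.
apply: ccvg_near; near=> n.
have n0 : (n%:R : R[i]) != 0.
  rewrite pnatr_eq0 -lt0n; near: n; exact: nbhs_infty_gt.
rewrite exprMn -cexpMn mulrN (mulrCA _ b) divff // mulr1 (cexpN b) mulfVK //; exact: cexp_neq0.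
Unshelve. all: by end_near. Qed.

End DoublingLimits.

(** * The Barnes function as a limit of weighted products *)

Section Barnes.
Variable R : realType.
Implicit Types (z : R[i]).
Local Notation t m := (m%:R^-1 : R[i]).

Lemma euler_gamma_cvg :
  (fun n : nat => \sum_(1 <= k < n.+1) k%:R^-1 - ln n%:R : R) @ \oo --> euler_gamma R.
Proof.
have [K [M _ hM]] := ln_step_expand R.
apply: (@cauchy_inv_cvg _ _ (`|K| + 1)).
exists M.+1 => // n /= Mn N nN.
have n0 : (0 < n)%N by exact: leq_ltn_trans Mn.
have -> : \sum_(1 <= k < N.+1) k%:R^-1 - ln N%:R - (\sum_(1 <= k < n.+1) k%:R^-1 - ln n%:R)
  = \sum_(n.+1 <= k < N.+1) (k%:R^-1 - (ln k%:R - ln k.-1%:R)) :> R.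
  have tel : \sum_(n.+1 <= k < N.+1) (ln k%:R - ln k.-1%:R) = ln N%:R - ln n%:R :> R.
    by rewrite big_add1 telescope_sumr.
  rewrite sumrB tel.
  rewrite (@big_cat_nat _ _ _ n.+1 1 N.+1) //=.
  by ring.
apply: le_trans (ler_norm_sum _ _ _) _.
apply: (@le_trans _ _ (\sum_(n.+1 <= k < N.+1) (`|K| + 1) * (k%:R^-1 : R) ^+ 2)); last first.
  by rewrite -big_distrr /=; apply: ler_wpM2l; rewrite ?addr_ge0 // sum_inv_sqr_le.
apply: ler_sum_nat => k /andP[nk _].
have Mk : (M <= k)%N by exact: leq_trans (ltnW Mn) (ltnW nk).
have k1 : (k%:R^-1 : R) <= 1 by rewrite invf_le1 ?ltr0n ?ler1n (leq_trans _ nk).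
have k2 : 0 <= (k%:R^-1 : R) by rewrite invr_ge0.
have := hM k Mk.
have -> : t k = (k%:R^-1 : R)%:C by rewrite fmorphV rmorph_nat.
have -> : (2^-1 : R[i]) = (2^-1 : R)%:C by rewrite fmorphV rmorph_nat.
rewrite -rmorphXn -rmorphM -rmorphD -rmorphB normc_real /=.
move: k1 k2; move: (k%:R^-1 : R) (_ - ln k.-1%:R) => s x s1 s0 h.
have h2 : K * s ^+ 3 <= `|K| * s ^+ 2.
  apply: (@le_trans _ _ (`|K| * s ^+ 3)).
    by apply: ler_wpM2r; rewrite ?ler_norm // exprn_ge0.
  by apply: ler_wpM2l => //; rewrite exprSr ler_piMr // exprn_ge0.
have s2 := sqr_ge0 s.
move: (le_trans h h2); rewrite !ler_norml mulrDl mul1r => /andP[??]; apply/andP; split; lra.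
Qed.

Definition barnes_factor z k := (1 + z / k%:R) ^+ k * cexp (- z + z ^+ 2 / (2 * k%:R)).

Lemma expand2_affine z : expand2 (fun m => 1 + z / m%:R) z 0.
Proof.
by exists 0; apply: nearW => m; rewrite mul0r addr0 subrr Normc.normc0 mul0r.
Qed.

(** The factor is the k-th power of (1 + z/k) exp(-z/k + z^2/(2 k^2)), whose
    expansion has no terms of order one and two: it is 1 + O(k^-3), and its k-th
    power is 1 + O(k^-2). *)
Lemma barnes_factor_near1 z :
  exists C : R, \forall k \near \oo, normc (barnes_factor z k - 1) <= C * k%:R^-1 ^+ 2.
Proof.
have he : Ocube (fun m => (- z * t m + z ^+ 2 / 2 * t m ^+ 2) - (- z * t m + z ^+ 2 / 2 * t m ^+ 2)).
  by exists 0; apply: nearW => m; rewrite subrr Normc.normc0 mul0r.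
have := expand2M (expand2_affine z) (expand2_cexp he).
set b := (X in expand2 _ _ X); have -> : b = 0 by rewrite /b; field.
rewrite subrr => -[K hK].
have K0 : 0 < 2 * (`|K| + 1) by rewrite mulr_gt0 // ltr_wpDl.
exists (2 * `|K|); near=> k.
have k0 : (0 : R) < k%:R by rewrite ltr0n; near: k; exact: nbhs_infty_gt.
have kc : (k%:R : R[i]) != 0 by rewrite pnatr_eq0 -lt0n -(ltr0n R).
have : normc ((1 + z / k%:R) * cexp (- z * t k + z ^+ 2 / 2 * t k ^+ 2) - (1 + 0 * t k + 0 * t k ^+ 2)) <= K * k%:R^-1 ^+ 3.
  by near: k.
rewrite !mul0r !addr0; set y := _ * cexp _ => hy.
have -> : barnes_factor z k = y ^+ k.
  rewrite /barnes_factor /y exprMn -cexpMn; congr (_ * cexp _).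
  by field.
have h1 : normc (y - 1) <= `|K| * k%:R^-1 ^+ 3.
  apply: le_trans hy _.
  by apply: ler_wpM2r; rewrite ?ler_norm // exprn_ge0 // invr_ge0.
have e : k%:R * (`|K| * k%:R^-1 ^+ 3) = `|K| * k%:R^-1 ^+ 2 :> R.
  by field; rewrite gt_eqF.
have h2 : k%:R^-1 < 1 / (2 * (`|K| + 1)).
  by near: k; apply: near_inv_small; rewrite divr_gt0.
have /andP[s0 s1] : 0 < (k%:R^-1 : R) <= 1 by near: k; exact: near_inv_le1.
rewrite -mulrA -e; apply: normc_expn_sub1_le => //; rewrite e.
move: h2; rewrite ltr_pdivlMr //.
have : 0 <= `|K| by [].
move: s0 s1; move: (k%:R^-1) (`|K|) => s k' s0 s1 k'0 h2.
have : k' * s ^+ 2 <= k' * s by rewrite ler_wpM2l // expr2 ler_piMr // ltW.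
lra.
Unshelve. all: by end_near. Qed.

Lemma barnes_prod_ccvg z :
  ccvg (fun N => \prod_(1 <= k < N.+1) barnes_factor z k) (barnes_prod z).
Proof.
have [C hC] := barnes_factor_near1 z.
have [l hl] := prod_ccvg hC.
suff -> : barnes_prod z = l by [].
by apply: cvg_lim hl.
Qed.

Lemma barnes_prod_neq0 z : (forall k, (0 < k)%N -> 1 + z / k%:R != 0) ->
  barnes_prod z != 0.
Proof.
move=> h; have [C hC] := barnes_factor_near1 z.
apply: (prod_ccvg_neq0 hC _ (@barnes_prod_ccvg z)) => k k0.
by rewrite mulf_neq0 ?cexp_neq0 // expf_neq0 // h.
Qed.

Lemma barnes_prod_eq0 m : (0 < m)%N -> barnes_prod (- m%:R : R[i]) = 0.
Proof.
move=> m0; apply: ccvg_unique (@barnes_prod_ccvg _) _.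
apply: ccvg_near (@ccvg_cst R 0); exists m => // N /= mN; apply/esym/eqP.
rewrite prodf_seq_eq0; apply/hasP; exists m; first by rewrite mem_index_iota m0 ltnS.
rewrite /barnes_factor mulNr divff ?pnatr_eq0 -?lt0n // subrr expr0n.
by rewrite gtn_eqF //= mul0r.
Qed.

(** G(1 + z) without (2 pi)^(z/2) exp(-z (z + 1)/2): the part that is the limit
    of the normalized weighted products of 1 + z/k. *)
Definition barnes_core z := barnes_prod z * cexp (- ((euler_gamma R)%:C * z ^+ 2 / 2)).

Lemma barnesG1pE z : barnesG1p z =
  cpow (2 * pi) (z / 2) * cexp (- ((z + 1) * z / 2)) * barnes_core z.
Proof.
by rewrite /barnesG1p /barnes_core cexpD; ring.
Qed.

(** The exponential factors of the defining product contribute the harmonic sum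
    to the exponent; Euler's constant turns it into a logarithm. *)
Lemma barnes_core_ccvg z :
  ccvg (fun N => \prod_(1 <= k < N.+1) (1 + z / k%:R) ^+ k *
                 cexp (z ^+ 2 / 2 * (ln N%:R : R)%:C - z * N%:R)) (barnes_core z).
Proof.
have h := ccvgM (@barnes_prod_ccvg z)
  (ccvg_cexp (ccvgM (@ccvg_cst R (- (z ^+ 2 / 2))) (ccvg_real euler_gamma_cvg))).
have -> : barnes_core z = barnes_prod z * cexp (- (z ^+ 2 / 2) * (euler_gamma R)%:C).
  by rewrite /barnes_core; congr (_ * cexp _); ring.
apply: ccvg_near h; apply: nearW => N.
rewrite /barnes_factor big_split /= -cexp_sum -[LHS]mulrA -cexpD; congr (_ * cexp _).
rewrite big_split /= sumr_const_nat subn1 /=.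
under [X in _ + X + _]eq_big_nat => k /andP[k0 _].
  rewrite invfM mulrA; over.
rewrite -big_distrr /= rmorphB rmorph_sum /=.
under [X in _ * (X - _)]eq_bigr do rewrite fmorphV rmorph_nat.
by rewrite -mulr_natr; ring.
Qed.

End Barnes.

(** * Fourier coefficients of the symbol *)

Section FourierCoefficients.
Variable R : realType.
Local Notation iC := (0 +i* 1 : R[i]).
Local Notation mu := (@lebesgue_measure R).

Lemma integral_FTC2 (f F : R -> R) (a b : R) : a < b ->
  (forall x, is_derive x (1 : R) F (f x)) -> continuous f ->
  (\int[mu]_(x in `[a, b]) (f x)%:E = (F b - F a)%:E)%E.
Proof.
move=> ab dF cf; rewrite EFinB; apply: continuous_FTC2 => //.
- by apply: continuous_subspaceT => x; exact: cf.
- have cF (x : R) : F y @[y --> x] --> F x.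
    apply/differentiable_continuous; rewrite -derivable1_diffP.
    by have [] := dF x.
  split=> [x _||]; first by have [] := dF x.
    exact: cvg_at_right_filter (cF a).
  exact: cvg_at_left_filter (cF b).
- by move=> x _; rewrite derive1E; have [_ ->] := dF x.
Qed.

(** The fundamental theorem of calculus for a function with one jump, at b, where
    its value is that of the second piece. *)
Lemma Rintegral_glue (f f1 f2 F1 F2 : R -> R) (a b c : R) : a < b -> b < c ->
  (forall x, is_derive x (1 : R) F1 (f1 x)) -> continuous f1 ->
  (forall x, is_derive x (1 : R) F2 (f2 x)) -> continuous f2 ->
  (forall x, a <= x < b -> f x = f1 x) -> (forall x, b <= x <= c -> f x = f2 x) ->
  \int[mu]_(x in `[a, c]) f x = (F1 b - F1 a) + (F2 c - F2 b).
Proof.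
move=> ab bc dF1 cf1 dF2 cf2 h1 h2.
have e1 : {in `[a, b[%classic, f1 =1 f}.
  by move=> x; rewrite inE /= in_itv /= => /h1.
have e2 : {in `[b, c]%classic, f2 =1 f}.
  by move=> x; rewrite inE /= in_itv /= => /h2.
have m1 D : measurable D -> measurable_fun D f1.
  by move=> mD; apply: measurable_funTS; exact: continuous_measurable_fun.
have m2 D : measurable D -> measurable_fun D f2.
  by move=> mD; apply: measurable_funTS; exact: continuous_measurable_fun.
rewrite /Rintegral (@itv_bndbnd_setU _ _ _ (BLeft b)) ?bnd_simp ?(ltW ab) ?(ltW bc) //.
rewrite integral_setU_EFin //=; last 2 first.
- apply/measurable_funU => //; split.
    by apply: eq_measurable_fun e1 _; exact: m1.
  by apply: eq_measurable_fun e2 _; exact: m2.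
- rewrite disj_set2E; apply/eqP/seteqP; split=> x //=.
  by rewrite !in_itv /= => -[/andP[_ h] /andP[/le_lt_trans /(_ h)]]; rewrite ltxx.
have -> : (\int[mu]_(x in `[a, b[) (f x)%:E = (F1 b - F1 a)%:E)%E.
  rewrite -(integral_FTC2 ab dF1 cf1) -integral_itv_bndo_bndc; last first.
    by apply/measurable_EFinP; exact: m1.
  by apply: eq_integral => x /e1 ->.
have -> : (\int[mu]_(x in `[b, c]) (f x)%:E = (F2 c - F2 b)%:E)%E.
  by rewrite -(integral_FTC2 bc dF2 cf2); apply: eq_integral => x /e2 ->.
by [].
Qed.

Lemma is_derive_Re_cexp (C w : R[i]) (x : R) :
  is_derive x (1 : R) (fun y : R => complex.Re (C * cexp (w * y%:C)))
    (complex.Re (C * w * cexp (w * x%:C))).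
Proof.
case: C w => p q [u v].
have -> : (fun y : R => complex.Re ((p +i* q) * cexp ((u +i* v) * y%:C))) =
    (fun y : R => expR (u * y) * (p * cos (v * y) - q * sin (v * y))).
  apply/funext => y; rewrite /cexp /= !mulr0 subr0 add0r.
  by rewrite !mul0r subr0 addr0; ring.
rewrite /cexp /= !mulr0 subr0 add0r !mul0r subr0 addr0.
have du : is_derive x (1 : R) (fun y : R => u * y) u.
  by apply: is_derive_eq; rewrite /GRing.scale /= ; ring.
have dv : is_derive x (1 : R) (fun y : R => v * y) v.
  by apply: is_derive_eq; rewrite /GRing.scale /= ; ring.
have de : is_derive x (1 : R) (fun y : R => expR (u * y)) (expR (u * x) * u).
  exact: (@is_derive1_comp _ (@expR R) (fun y : R => u * y)).
have dc : is_derive x (1 : R) (fun y : R => cos (v * y)) (- sin (v * x) * v).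
  exact: (@is_derive1_comp _ (@cos R) (fun y : R => v * y)).
have ds : is_derive x (1 : R) (fun y : R => sin (v * y)) (cos (v * x) * v).
  exact: (@is_derive1_comp _ (@sin R) (fun y : R => v * y)).
apply: is_derive_eq; rewrite /GRing.scale /=; ring.
Qed.

Lemma continuous_Re_cexp (C w : R[i]) :
  continuous (fun y : R => complex.Re (C * cexp (w * y%:C))).
Proof.
move=> x; apply/differentiable_continuous; rewrite -derivable1_diffP.
by have [] := is_derive_Re_cexp C w x.
Qed.

(** The imaginary part of z is the real part of - i z, so both components reduce
    to real parts of exponentials. *)
Lemma cintegral_glue (f : R -> R[i]) (C1 C2 w : R[i]) (a b c : R) :
  w != 0 -> a < b -> b < c ->
  (forall x, a <= x < b -> f x = C1 * cexp (w * x%:C)) ->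
  (forall x, b <= x <= c -> f x = C2 * cexp (w * x%:C)) ->
  cintegral a c f = C1 / w * (cexp (w * b%:C) - cexp (w * a%:C)) +
                    C2 / w * (cexp (w * c%:C) - cexp (w * b%:C)).
Proof.
move=> w0 ab bc h1 h2; rewrite /cintegral.
have Im_Re z : complex.Im z = complex.Re (- iC * z).
  by case: z => p q /=; ring.
have dF K x : is_derive x (1 : R) (fun y : R => complex.Re (K / w * cexp (w * y%:C)))
    (complex.Re (K * cexp (w * x%:C))).
  by have := is_derive_Re_cexp (K / w) w x; rewrite divfK.
rewrite (Rintegral_glue ab bc (dF C1) (@continuous_Re_cexp _ _) (dF C2)
  (@continuous_Re_cexp _ _)); last 2 first.
- by move=> x /h1 ->.
- by move=> x /h2 ->.
rewrite (Rintegral_glue ab bc (dF (- iC * C1)) (@continuous_Re_cexp _ _) (dF (- iC * C2))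
  (@continuous_Re_cexp _ _)); last 2 first.
- by move=> x /h1 ->; rewrite Im_Re mulrA.
- by move=> x /h2 ->; rewrite Im_Re mulrA.
rewrite -!mulrA -!Im_Re -!raddfB -!raddfD -!mulrBr.
by have ReIm z : complex.Re z +i* complex.Im z = z :> R[i]; [case: z|exact: ReIm].
Qed.

Lemma expiE (x : R) : expi x = cos x +i* sin x.
Proof.
by rewrite /expi /cexp /= !mul0r !mulr0 subr0 mul1r add0r expR0 mul1r.
Qed.

Lemma circle_arg_shift (x : R) : 0 <= x <= 2 * pi ->
  circle_arg (- expi x) - pi = if x < pi then x else x - 2 * pi.
Proof.
move=> /andP[x0 x2]; rewrite expiE /circle_arg /=.
have p0 := pi_gt0 R.
case: ltP => xp.
  case: ifPn => s0.
    have [->|xn0] := eqVneq x 0.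
      by rewrite cos0 acosN1 subrr.
    have : 0 < sin x by apply: sin_gt0_pi; rewrite lt_neqAle eq_sym xn0 x0.
    by move: s0; rewrite oppr_ge0 => /le_lt_trans h /h; rewrite ltxx.
  rewrite -cosDpi -cosN.
  have -> : cos (- (x + pi)) = cos (pi - x).
    by rewrite cosN cosDpi cosB cospi sinpi mul0r addr0 mulN1r.
  by rewrite cosK ?in_itv /=; lra.
have s : 0 <= sin (x - pi) by apply: sin_ge0_pi; lra.
have <- : sin (x - pi) = - sin x by rewrite sinB cospi sinpi mulr0 subr0 mulrN1.
have <- : cos (x - pi) = - cos x by rewrite cosB cospi sinpi mulr0 addr0 mulrN1.
by rewrite s cosK ?in_itv /=; lra.
Qed.

Lemma t_shift_expi (beta : R[i]) (x : R) : 0 <= x <= 2 * pi ->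
  t_shift beta (expi x) = cexp (iC * beta * (if x < pi then x else x - 2 * pi)%:C).
Proof. by move=> hx; rewrite /t_shift /t_symbol circle_arg_shift. Qed.

Lemma expi_int (k : int) : expi (k%:~R * (2 * pi) : R) = 1.
Proof.
have e2 : expi (2 * pi : R) = 1.
  by rewrite expiE mulr_natl cos2pi sin2pi.
have en (n : nat) : expi (n%:R * (2 * pi) : R) = 1.
  rewrite /expi rmorphM rmorph_nat mulrCA cexpMn.
  by rewrite -/(expi (2 * pi)) e2 expr1n.
case: k => n; first by rewrite -pmulrn en.
rewrite NegzE mulrNz -pmulrn mulNr /expi rmorphN mulrN cexpN.
by rewrite -/(expi _) en invr1.
Qed.

Lemma expi_int_pi (k : int) : expi (k%:~R * pi : R) = (-1) ^ k.
Proof.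
have e2 : expi (pi : R) = -1.
  by rewrite expiE cospi sinpi; apply/eqP; rewrite eq_complex /= oppr0 !eqxx.
have en (n : nat) : expi (n%:R * pi : R) = (-1) ^+ n.
  rewrite /expi rmorphM rmorph_nat mulrCA cexpMn.
  by rewrite -/(expi pi) e2.
case: k => n; first by rewrite -pmulrn en.
rewrite NegzE mulrNz -pmulrn mulNr /expi rmorphN mulrN cexpN.
by rewrite -/(expi _) en.
Qed.

(** This is sin(pi beta) / pi. *)
Definition sin_over_pi (beta : R[i]) : R[i] :=
  (cexp (iC * beta * pi%:C) - cexp (- (iC * beta * pi%:C))) / (2 * iC * pi%:C).

Lemma iC_neq0 : iC != 0.
Proof. by rewrite eq_complex /= oner_eq0 andbF. Qed.

Lemma fourier_t_shift (beta : R[i]) (k : int) : beta != k%:~R ->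
  fourier (t_shift beta) k = (-1) ^ k * sin_over_pi beta / (beta - k%:~R).
Proof.
move=> bk; set l := beta - k%:~R.
have l0 : l != 0 by rewrite subr_eq0.
have p0 := pi_gt0 R.
have pc : (pi%:C : R[i]) != 0 by rewrite eq_complex /= gt_eqF.
have w0 : iC * l != 0 by rewrite mulf_neq0 // iC_neq0.
have ek (x : R) : expi (- (k%:~R * x)) = cexp (- (iC * k%:~R * x%:C)).
  by rewrite /expi rmorphN rmorphM rmorph_int mulrN mulrA.
(* On [pi, 2 pi] the symbol is exp(i beta (theta - 2 pi)), whence the second
   constant. *)
rewrite /fourier (@cintegral_glue _ 1 (cexp (- (iC * beta * (2 * pi)%:C))) (iC * l) 0 pi (2 * pi)) //; last 3 first.
- lra.
- move=> x /andP[x0 xp]; rewrite t_shift_expi; last by apply/andP; split; lra.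
  by rewrite xp ek -cexpD mul1r /l; congr cexp; ring.
- move=> x /andP[xp x2]; rewrite t_shift_expi; last by apply/andP; split; lra.
  by rewrite ltNge xp /= ek -!cexpD /l rmorphB; congr cexp; ring.
have E1 : cexp (iC * l * pi%:C) = (-1) ^ k * cexp (iC * beta * pi%:C).
  have -> : iC * l * pi%:C = iC * beta * pi%:C - iC * k%:~R * pi%:C by rewrite /l; ring.
  rewrite cexpD mulrC -ek; congr (_ * _).
  have -> : - (k%:~R * pi) = (- k)%:~R * pi :> R by rewrite mulrNz mulNr.
  rewrite expi_int_pi; case: k {bk l l0 w0 ek} => n; last first.
    by rewrite NegzE opprK /exprz /= -exprVn invrN1.
  by case: n => // n; rewrite -NegzE /exprz /= -exprVn invrN1.
have E2 : cexp (iC * l * (2 * pi)%:C) = cexp (iC * beta * (2 * pi)%:C).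
  have -> : iC * l * (2 * pi)%:C = iC * beta * (2 * pi)%:C - iC * k%:~R * (2 * pi)%:C.
    by rewrite /l; ring.
  rewrite cexpD -ek.
  have -> : - (k%:~R * (2 * pi)) = (- k)%:~R * (2 * pi) :> R by rewrite mulrNz mulNr.
  by rewrite expi_int mulr1.
have E3 : cexp (- (iC * beta * (2 * pi)%:C)) * cexp (iC * beta * pi%:C) = cexp (- (iC * beta * pi%:C)).
  by rewrite -cexpD rmorphM rmorph_nat; congr cexp; ring.
rewrite E1 E2; clearbody l; rewrite rmorph0 mulr0 cexp0 !mulrBr.
have -> : cexp (- (iC * beta * (2 * pi)%:C)) / (iC * l) * cexp (iC * beta * (2 * pi)%:C) = (iC * l)^-1.
  by rewrite mulrAC -cexpD addNr cexp0 mul1r.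
have -> : cexp (- (iC * beta * (2 * pi)%:C)) / (iC * l) * ((-1) ^ k * cexp (iC * beta * pi%:C)) =
   (iC * l)^-1 * (-1) ^ k * cexp (- (iC * beta * pi%:C)) by rewrite -E3; ring.
have -> : ((2 * pi)^-1)%:C = (2 * pi%:C)^-1 :> R[i] by rewrite fmorphV rmorphM rmorph_nat.
rewrite /sin_over_pi.
move: (cexp _) (cexp _) ((-1) ^ k) => X Y s; move: pc; move: (pi%:C) => p pc.
by field; rewrite l0 pc iC_neq0.
Qed.

End FourierCoefficients.

(** * Euler's product for the sine *)

Section SineProduct.
Variable R : realType.
Local Notation iC := (0 +i* 1 : R[i]).

Lemma ccvg_neq0 (u : nat -> R[i]) (l : R[i]) : l != 0 -> ccvg u l ->
  \forall n \near \oo, u n != 0.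
Proof.
move=> l0 /ccvgP /(_ (normc l)); rewrite normc_gt0 => /(_ l0).
apply: filterS => n; apply: contraTneq => ->.
by rewrite sub0r normcN ltxx.
Qed.

(** Tannery's theorem for products: a uniform quadratic bound on the factors
    allows to take the limit factor by factor. *)
Lemma prod_tannery (a : nat -> nat -> R[i]) (l : nat -> R[i]) (C : R) (S : R[i]) :
  (forall k, (0 < k)%N -> ccvg (fun N => a N k) (l k)) ->
  (\forall N \near \oo, forall k, (0 < k <= N)%N -> normc (a N k) <= C * k%:R^-1 ^+ 2) ->
  ccvg (fun N => \prod_(1 <= k < N.+1) (1 + a N k)) S ->
  ccvg (fun M => \prod_(1 <= k < M.+1) (1 + l k)) S.
Proof.
move=> hl [N0 _ hN0] hS.
have C0 : 0 <= C.
  have := hN0 N0.+1 (leqnSn _) 1%N isT.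
  by rewrite invr1 expr1n mulr1; apply: le_trans; exact: normc_ge0.
pose B := expR (C * 2).
have bnd N M : (N0 <= N)%N -> (M <= N)%N ->
    normc (\prod_(1 <= k < M.+1) (1 + a N k)) <= B.
  move=> N0N MN; rewrite normc_prod.
  apply: (@le_trans _ _ (\prod_(1 <= k < M.+1) expR (C * k%:R^-1 ^+ 2))).
    rewrite big_nat_cond [X in _ <= X]big_nat_cond.
    apply: ler_prod => k; rewrite andbT ltnS => /andP[k0 kM].
    rewrite normc_ge0 /=; apply: le_trans (le_normcD _ _) _.
    rewrite Normc.normc1; apply: le_trans (expR_ge1Dx _); rewrite lerD2l.
    by apply: hN0 => //; rewrite k0 (leq_trans kM).
  rewrite -expR_sum ler_expR -big_distrr /=; apply: ler_wpM2l => //.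
  case: M MN => [|M] MN; first by rewrite big_geq.
  rewrite big_ltn // invr1 expr1n -[X in _ <= X]/(1 + 1) lerD2l.
  by have := @sum_inv_sqr_le R 1 M.+1 isT isT; rewrite invr1.
apply: (@ccvg_bound _ (B * (2 * C))).
have C1 : 0 < 2 * (C + 1) by rewrite mulr_gt0 // ltr_wpDl.
near=> M.
have M0 : (0 < M)%N by near: M; exact: nbhs_infty_gt.
have MC : C * M%:R^-1 <= 1 / 2.
  have : M%:R^-1 < 1 / (2 * (C + 1)) by near: M; apply: near_inv_small; rewrite divr_gt0.
  rewrite ltr_pdivlMr //; have : 0 <= (M%:R^-1 : R) by rewrite invr_ge0.
  by move: (M%:R^-1) => s; nra.
have key : \forall N \near \oo,
   normc (\prod_(1 <= k < N.+1) (1 + a N k) - \prod_(1 <= k < M.+1) (1 + a N k) - 0)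
     <= B * (2 * C) * M%:R^-1.
  exists (maxn N0 M) => // N /=; rewrite geq_max => /andP[N0N MN].
  rewrite subr0 (prod_split _ MN) -[X in _ * _ - X]mulr1 -mulrBr Normc.normcM.
  rewrite -[X in _ <= X]mulrA; apply: ler_pM; [exact: normc_ge0|exact: normc_ge0|exact: bnd|].
  have hs : \sum_(M.+1 <= k < N.+1) C * (k%:R^-1 : R) ^+ 2 <= C * M%:R^-1.
    by rewrite -big_distrr /=; apply: ler_wpM2l => //; exact: sum_inv_sqr_le.
  apply: le_trans (@normc_prod_sub1_le _ _ _ _ (fun k => C * k%:R^-1 ^+ 2) _ _) _.
  - move=> k; rewrite mem_index_iota ltnS => /andP[Mk kN].
    by rewrite addrAC subrr add0r; apply: hN0 => //; rewrite (leq_trans _ Mk).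
  - exact: le_trans MC.
  - by rewrite -mulrA ler_wpM2l.
have hM : ccvg (fun N => \prod_(1 <= k < M.+1) (1 + a N k)) (\prod_(1 <= k < M.+1) (1 + l k)).
  apply: (@ccvg_prod _ _ _ (fun k N => 1 + a N k) (fun k => 1 + l k)) => k.
  rewrite mem_index_iota => /andP[k0 _].
  by apply: ccvgD; [exact: ccvg_cst|exact: hl].
have := ccvg_normc_le (ccvgB hS hM) key.
by rewrite subr0 normcB.
Unshelve. all: by end_near. Qed.

(** On [0, 1/2] the cubic Taylor bound gives 3/4; beyond, sin x >= sin(1/2) >= 3/8
    by monotonicity, and x <= pi/2 < 2. *)
Lemma sin_lower_bound (x : R) : 0 <= x <= pi / 2 -> 3 / 16 * x <= sin x.
Proof.
move=> /andP[x0 xp].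
have small (y : R) : 0 <= y <= 1 / 2 -> 3 / 4 * y <= sin y.
  move=> /andP[y0 y1]; have := sin_taylor1 y; rewrite (ger0_norm y0).
  have : y ^+ 3 <= y * (1 / 4).
    by rewrite exprS; apply: ler_wpM2l => //; nra.
  by rewrite ler_norml => h /andP[]; lra.
have [x1|x1] := leP x (1 / 2); first by have := small x; rewrite x0 x1 => /(_ isT); lra.
have h := small (1 / 2).
have p2 := pihalf_lt2 R.
have : sin (1 / 2) <= sin x.
  by apply: ltW; rewrite ltr_sin ?in_itv /=; lra.
have : 3 / 4 * (1 / 2) <= sin (1 / 2 : R) by apply: h; lra.
lra.
Qed.

(** With n = 2N + 1 and zeta a primitive n-th root of unity, x^n - y^n is the
    product of the x - zeta^k y. Pairing k with n - k gives a finite product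
    whose limit, at x = exp(i pi beta / n) and y = 1/x, is Euler's. *)
Section FiniteProduct.
Variable N : nat.
Let n := N.*2.+1.
Let zeta : R[i] := expi (2 * pi / n%:R).
Let sn k : R := sin (pi * k%:R / n%:R).

Let nR : (n%:R : R) != 0. Proof. by rewrite pnatr_eq0. Qed.

Lemma expiX (x : R) k : expi x ^+ k = expi (k%:R * x).
Proof. by rewrite /expi -cexpMn rmorphM rmorph_nat; congr cexp; ring. Qed.

Lemma zetaX k : zeta ^+ k = expi (2 * (pi * k%:R / n%:R)).
Proof. by rewrite expiX; congr expi; ring. Qed.

Lemma expi_double (x : R) : complex.Re (expi (2 * x)) = 1 - 2 * sin x ^+ 2.
Proof.
rewrite expiE /= (_ : 2 * x = x + x); last by ring.
have -> : cos (x + x) = cos x ^+ 2 - sin x ^+ 2 by rewrite cosD !expr2.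
have -> : cos x ^+ 2 = 1 - sin x ^+ 2 by rewrite -[in RHS](cos2Dsin2 x) addrK.
by ring.
Qed.

Lemma sn_gt0 k : (0 < k < n)%N -> 0 < sn k.
Proof.
move=> /andP[k0 kn]; apply: sin_gt0_pi; have p0 := pi_gt0 R.
have n0 : (0 : R) < n%:R by rewrite ltr0n.
rewrite divr_gt0 // ?mulr_gt0 ?ltr0n //= ltr_pdivrMr // ltr_pM2l //.
by rewrite ltr_nat.
Qed.

Lemma zeta_n : zeta ^+ n = 1.
Proof.
rewrite zetaX mulfK // expiE mulr_natl cos2pi sin2pi.
by apply/eqP; rewrite eq_complex /= !eqxx.
Qed.

Lemma zeta_prim : n.-primitive_root zeta.
Proof.
rewrite /primitive_root_of_unity /=; apply/forallP => -[i /= ilt].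
rewrite unity_rootE; apply/eqP; case: (ltngtP i.+1 n) => [iN|//|->]; last first.
- by rewrite zeta_n eqxx.
- by rewrite ltnNge ilt.
apply/negbTE/eqP => h.
have : complex.Re (zeta ^+ i.+1) = 1 by rewrite h.
rewrite zetaX expi_double => /eqP; rewrite -subr_eq0 addrAC subrr add0r oppr_eq0.
by rewrite mulf_eq0 pnatr_eq0 /= sqrf_eq0 gt_eqF // (@sn_gt0 i.+1).
Qed.

Lemma zeta_pair (x y : R[i]) k : (0 < k < n)%N -> x * y = 1 ->
  (x - zeta ^+ k * y) * (x - zeta ^+ (n - k) * y) = (x - y) ^+ 2 + 4 * (sn k ^+ 2)%:C.
Proof.
move=> /andP[k0 kn] xy.
have e1 : zeta ^+ k * zeta ^+ (n - k) = 1 by rewrite -exprD subnKC ?zeta_n // ltnW.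
have e2 : zeta ^+ k + zeta ^+ (n - k) = 2 - 4 * (sn k ^+ 2)%:C.
  have -> : zeta ^+ (n - k) = expi (- (2 * (pi * k%:R / n%:R))).
    have z0 : zeta ^+ k != 0 by rewrite expf_neq0 // cexp_neq0.
    apply: (mulfI z0); rewrite e1 zetaX /expi rmorphN mulrN -cexpD subrr cexp0 //.
  rewrite zetaX !expiE cosN sinN.
  have := expi_double (pi * k%:R / n%:R); rewrite expiE /= -/(sn k) => ->.
  have e4 : (4 * (sn k ^+ 2)%:C : R[i]) = (4 * sn k ^+ 2)%:C.
    by rewrite [RHS]rmorphM rmorph_nat.
  have e2' : (2 : R[i]) = (2 : R)%:C by rewrite (real_complex_nat R 2).
  rewrite e4 e2' -rmorphB; apply/eqP; rewrite eq_complex /=.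
  by apply/andP; split; apply/eqP; ring.
have -> : (x - zeta ^+ k * y) * (x - zeta ^+ (n - k) * y) =
  x ^+ 2 - (zeta ^+ k + zeta ^+ (n - k)) * (x * y) + zeta ^+ k * zeta ^+ (n - k) * y ^+ 2.
  by ring.
rewrite e1 e2 xy mulr1 mul1r.
have -> : (x - y) ^+ 2 = x ^+ 2 + y ^+ 2 - 2 * (x * y) by ring.
by rewrite xy; ring.
Qed.

Lemma prod_pairs (x y : R[i]) : x * y = 1 ->
  \prod_(1 <= i < n) (x - zeta ^+ i * y) =
  \prod_(1 <= k < N.+1) ((x - y) ^+ 2 + 4 * (sn k ^+ 2)%:C).
Proof.
move=> xy.
have Nn : (N.+1 <= n)%N by rewrite /n ltnS -addnn leq_addr.
rewrite (big_cat_nat _ Nn) //=.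
rewrite [X in _ * X](_ : _ = \prod_(1 <= i < N.+1) (x - zeta ^+ (n - i) * y)); last first.
  rewrite big_nat_rev /= [LHS](big_addn 0 _ N.+1) [RHS]big_add1 /=.
  have -> : (n - N.+1 = N)%N by rewrite /n -addnn subSS addnK.
  rewrite !big_mkord; apply: eq_bigr => i _.
  congr (x - zeta ^+ _ * y).
  have := ltn_ord i; rewrite /n -addnn; lia.
rewrite -big_split /=; apply: eq_big_nat => k /andP[k0 kN].
by rewrite zeta_pair // k0 (leq_trans kN).
Qed.

(** Both sides are the value at 1 of (X^n - 1) / (X - 1). *)
Lemma prod_sn : \prod_(1 <= k < N.+1) (4 * (sn k ^+ 2)%:C : R[i]) = n%:R.
Proof.
have := @prod_pairs 1 1 (mulr1 1); rewrite subrr expr0n /=.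
under [in RHS]eq_bigr do rewrite add0r.
move=> <-.
have f := factor_Xn_sub_1 zeta_prim.
rewrite big_ltn // expr0 subrX1 in f.
have := mulfI (negbT (polyXsubC_eq0 (1 : R[i]))) f.
move=> /(congr1 (fun p : {poly R[i]} => p.[1])).
rewrite horner_prod horner_sum.
under [X in _ = X]eq_bigr do rewrite hornerXn expr1n.
rewrite sumr_const card_ord => <-; apply: eq_bigr => i _.
by rewrite hornerXsubC mulr1.
Qed.

Lemma expn_sub_factor (x y : R[i]) : x * y = 1 ->
  x ^+ n - y ^+ n =
  n%:R * (x - y) * \prod_(1 <= k < N.+1) (1 + (x - y) ^+ 2 / (4 * (sn k ^+ 2)%:C)).
Proof.
move=> xy.
have y0 : y != 0 by apply: contra_eq_neq xy => ->; rewrite mulr0 eq_sym oner_eq0.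
have -> : x ^+ n - y ^+ n = (x - y) * \prod_(1 <= i < n) (x - zeta ^+ i * y).
  have h : ('X^n - 1 : {poly R[i]}).[x / y] = (x / y) ^+ n - 1.
    by rewrite hornerD hornerN hornerXn hornerC.
  rewrite -(factor_Xn_sub_1 zeta_prim) horner_prod in h.
  have -> : x ^+ n - y ^+ n = y ^+ n * ((x / y) ^+ n - 1).
    by rewrite mulrBr mulr1 -exprMn mulrC divfK.
  rewrite -h -[y ^+ n](_ : \prod_(0 <= i < n) y = _); last by rewrite prodr_const_nat subn0.
  rewrite -big_split /= big_ltn // expr0 hornerXsubC mulrBr mulr1 [y * (x / y)]mulrC divfK //.
  congr (_ * _); apply: eq_bigr => i _.
  by rewrite hornerXsubC mulrBr [y * (x / y)]mulrC divfK // [y * _]mulrC.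
rewrite prod_pairs // -prod_sn [X in _ = X * _]mulrC -mulrA -big_split /=.
congr (_ * _); apply: eq_big_nat => k /andP[k0 kN].
rewrite mulrDr mulr1 addrC; congr (_ + _); rewrite mulrC divfK //.
rewrite mulf_neq0 ?pnatr_eq0 // eq_complex /= negb_and expf_neq0 // gt_eqF //.
apply: sn_gt0; rewrite k0 (leq_trans kN) // /n ltnS -addnn leq_addr //.
Qed.

End FiniteProduct.

Lemma ccvg_double_sinh (w : R[i]) :
  ccvg (fun m => m%:R * (cexp (w / m%:R) - cexp (- (w / m%:R)))) (2 * w).
Proof.
have he (z : R[i]) : expand2 (fun m => cexp (z * m%:R^-1)) z (0 + z ^+ 2 / 2).
  apply: expand2_cexp; exists 0; apply: nearW => m.
  by rewrite mul0r addr0 subrr Normc.normc0 mul0r.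
have h : Ocube (fun m => cexp (w / m%:R) - cexp (- (w / m%:R)) - 2 * w * m%:R^-1).
  apply: Ocube_eq (OcubeD (he w) (OcubeM (he (- w)) (v := fun=> -1) (B := 1) _)); last first.
    by apply: nearW => m; rewrite normcN Normc.normc1.
  apply: nearW => m /=; rewrite mulNr; move: (_^-1) (cexp _) (cexp _) => s X Y.
  by field.
have [K hK] := h; apply: (@ccvg_bound _ `|K|); near=> m.
have m0 : (0 : R) < m%:R by rewrite ltr0n; near: m; exact: nbhs_infty_gt.
have mc : (m%:R : R[i]) != 0 by rewrite pnatr_eq0 -lt0n -(ltr0n R).
have hm : normc (cexp (w / m%:R) - cexp (- (w / m%:R)) - 2 * w * m%:R^-1) <= K * m%:R^-1 ^+ 3.
  by near: m.
set D := cexp _ - cexp _ in hm *.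
have -> : m%:R * D - 2 * w = m%:R * (D - 2 * w * m%:R^-1).
  by clearbody D; field.
rewrite Normc.normcM normc_nat -ler_pdivlMl //.
apply: le_trans hm _.
have /andP[s0 s1] : 0 < (m%:R^-1 : R) <= 1 by near: m; exact: near_inv_le1.
move: s0 s1; move: (m%:R^-1) => s s0 s1.
have -> : s * (`|K| * s) = `|K| * s ^+ 2 by ring.
apply: (@le_trans _ _ (`|K| * s ^+ 3)).
  by apply: ler_wpM2r; rewrite ?ler_norm // exprn_ge0 // ltW.
by apply: ler_wpM2l => //; rewrite exprSr ler_piMr // ?exprn_ge0 // ltW.
Unshelve. all: by end_near. Qed.

Lemma ccvg_sin_scaled (y : R) :
  ccvg (fun m => (m%:R * sin (y / m%:R))%:C) y%:C.
Proof.
apply: (@ccvg_bound _ (`|y| ^+ 3)); near=> m.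
have m0 : (0 : R) < m%:R by rewrite ltr0n; near: m; exact: nbhs_infty_gt.
have -> : (m%:R * sin (y / m%:R))%:C - y%:C = (m%:R * (sin (y / m%:R) - y / m%:R))%:C.
  by rewrite -rmorphB; congr (_%:C); field; rewrite gt_eqF.
rewrite normc_real normrM (ger0_norm (ltW m0)) -ler_pdivlMl //.
apply: le_trans (sin_taylor1 _) _.
rewrite normrM exprMn [`|m%:R^-1|]ger0_norm ?invr_ge0 //.
have /andP[s0 s1] : 0 < (m%:R^-1 : R) <= 1 by near: m; exact: near_inv_le1.
move: s0 s1; move: (m%:R^-1) => s s0 s1.
have -> : s * (`|y| ^+ 3 * s) = `|y| ^+ 3 * s ^+ 2 by ring.
by apply: ler_wpM2l; rewrite ?exprn_ge0 // exprSr ler_piMr // ?exprn_ge0 // ltW.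
Unshelve. all: by end_near. Qed.

(** With x = exp(w / n) and y = 1/x, n (x - y) tends to 2w and n sin(pi k / n)
    to pi k, so each factor of the finite product converges; the lower bound on
    the sine provides the domination. *)
Lemma sine_product (beta : R[i]) : beta != 0 ->
  ccvg (fun N => \prod_(1 <= k < N.+1) (1 + - (beta ^+ 2 / k%:R ^+ 2))) (sin_over_pi beta / beta).
Proof.
move=> b0.
have p0 := pi_gt0 R.
have pc : (pi%:C : R[i]) != 0 by rewrite eq_complex /= gt_eqF.
pose w := iC * beta * pi%:C.
have w0 : w != 0 by rewrite !mulf_neq0 // iC_neq0.
pose n N := N.*2.+1.
have nN N : (N <= n N)%N by rewrite /n -addnn leqW // leq_addr.
pose d N := (n N)%:R * (cexp (w / (n N)%:R) - cexp (- (w / (n N)%:R))).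
pose s N k : R := (n N)%:R * sin (pi * k%:R / (n N)%:R).
have nc N : ((n N)%:R : R[i]) != 0 by rewrite pnatr_eq0.
have nr N : (0 : R) < (n N)%:R by rewrite ltr0n.
have hd : ccvg d (2 * w).
  exact: (@ccvg_comp _ n (fun m => m%:R * (cexp (w / m%:R) - cexp (- (w / m%:R)))) _ nN (@ccvg_double_sinh w)).
have w20 : 2 * w != 0 by rewrite mulf_neq0 // pnatr_eq0.
have hs k : ccvg (fun N => (s N k)%:C) (pi * k%:R)%:C.
  exact: (@ccvg_comp _ n (fun m => (m%:R * sin (pi * k%:R / m%:R))%:C) _ nN (@ccvg_sin_scaled (pi * k%:R))).
pose a N k := d N ^+ 2 / (4 * (s N k)%:C ^+ 2).
pose c : R := 3 / 16 * pi.
have c0 : 0 < c by rewrite /c; lra.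
pose D : R := normc (2 * w) + 1.
apply: (@prod_tannery a _ (D ^+ 2 / (4 * c ^+ 2))).
- move=> k k0.
  have kc : (k%:R : R[i]) != 0 by rewrite pnatr_eq0 -lt0n.
  have e : - (beta ^+ 2 / k%:R ^+ 2) = (2 * w) ^+ 2 / (4 * (pi * k%:R)%:C ^+ 2).
    have -> : (pi * k%:R)%:C = pi%:C * k%:R :> R[i] by rewrite rmorphM rmorph_nat.
    rewrite /w.
    have i2 : iC ^+ 2 = -1 by exact: sqr_i.
    move: pc; move: (pi%:C) => p pc.
    have -> : (2 * (iC * beta * p)) ^+ 2 = 4 * (iC ^+ 2) * beta ^+ 2 * p ^+ 2 by ring.
    by rewrite i2; field; rewrite pc kc.
  rewrite e; apply: ccvgM; first exact: ccvgX.
  apply: ccvgV.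
    by rewrite mulf_neq0 ?pnatr_eq0 // expf_neq0 // rmorphM rmorph_nat mulf_neq0.
  by apply: ccvgM; [exact: ccvg_cst|apply: ccvgX; exact: hs].
- have /ccvgP /(_ 1 ltr01) := hd; apply: filterS => N hN k /andP[k0 kN].
  have dD : normc (d N) <= D.
    by apply: le_trans (normcDl _ (- (2 * w))) _; rewrite normcN addrC lerD2l ltW.
  have k0R : (0 : R) < k%:R by rewrite ltr0n.
  have sc : c * k%:R <= s N k.
    have -> : c * k%:R = (n N)%:R * (3 / 16 * (pi * k%:R / (n N)%:R)).
      by rewrite /c; move: (nr N); move: (n N)%:R pi => m p m0; field; rewrite gt_eqF.
    rewrite /s ler_pM2l //.
    apply: sin_lower_bound; apply/andP; split.
      by apply: divr_ge0 => //; apply: mulr_ge0 => //; exact: ltW.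
    rewrite ler_pdivrMr // -mulrA ler_pM2l // ler_pdivlMl // -natrM ler_nat /n.
    by rewrite -addnn; lia.
  have s0 : 0 < s N k by apply: lt_le_trans sc; rewrite mulr_gt0.
  rewrite /a Normc.normcM normcX Normc.normcV (Normc.normcM 4) normcX normc_real normc_nat.
  rewrite (ger0_norm (ltW s0)).
  have -> : D ^+ 2 / (4 * c ^+ 2) * k%:R^-1 ^+ 2 = D ^+ 2 / (4 * (c * k%:R) ^+ 2).
    by field; rewrite !gt_eqF.
  apply: ler_pM.
  - by apply: exprn_ge0; exact: normc_ge0.
  - by rewrite invr_ge0 mulr_ge0 // exprn_ge0 // ltW.
  - by rewrite lerXn2r ?nnegrE ?normc_ge0 // (le_trans (normc_ge0 _) dD).
  - have ck : 0 < c * k%:R by apply: mulr_gt0.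
    have hp (y : R) : 0 < y -> 4 * y ^+ 2 \is Num.pos.
      by move=> y0; rewrite posrE; apply: mulr_gt0 => //; apply: exprn_gt0.
    rewrite lef_pV2 ?hp //.
    by rewrite ler_pM2l // lerXn2r ?nnegrE // ltW // mulr_gt0.
- have h := ccvgM (@ccvg_cst R (2 * iC * pi%:C * sin_over_pi beta)) (ccvgV w20 hd).
  have e : sin_over_pi beta / beta = 2 * iC * pi%:C * sin_over_pi beta / (2 * w).
    rewrite /w; move: (sin_over_pi beta) pc; move: (pi%:C) => p S pc.
    by field; rewrite b0 pc iC_neq0.
  rewrite e; apply: ccvg_near h.
  have := ccvg_neq0 w20 hd; apply: filterS => N dN.
  have xy : cexp (w / (n N)%:R) * cexp (- (w / (n N)%:R)) = 1.
    by rewrite -cexpD subrr cexp0.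
  have := expn_sub_factor N xy; rewrite -!cexpMn mulrN mulrC divfK // -/(n N) -/(d N).
  have -> : 2 * iC * pi%:C * sin_over_pi beta = cexp w - cexp (- w).
    rewrite /sin_over_pi -/w; move: pc; move: (cexp w) (cexp (- w)) => X Y; move: (pi%:C) => p pc.
    by field; rewrite pc iC_neq0.
  move=> ->; rewrite mulrAC divff // mul1r; apply: eq_big_nat => k /andP[k0 kN].
  congr (1 + _); rewrite /a /d /s.
  have -> : forall (x : nat) (y : R), (x%:R * y)%:C = x%:R * y%:C :> R[i].
    by move=> x y; rewrite rmorphM rmorph_nat.
  have -> : forall y : R, (y ^+ 2)%:C = y%:C ^+ 2 :> R[i] by move=> y; rewrite rmorphXn.
  have sk : (sin (pi * k%:R / (n N)%:R))%:C != 0 :> R[i].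
    have := @sn_gt0 N k; rewrite -/(n N) => sk.
    rewrite eq_complex /= negb_and gt_eqF // sk // k0 (leq_trans kN) // /n.
    by rewrite ltnS -addnn leq_addr.
  move: (nc N) sk; move: (sin _)%:C (n N)%:R (cexp _ - _) => S m E m0 S0.
  by field; rewrite m0 S0.
Qed.

End SineProduct.

(** * The determinants and their zeros *)

Section CauchyDeterminant.
Variable F : fieldType.
Variables x y : nat -> F.

Definition cauchy_mx n : 'M[F]_n := \matrix_(i < n, j < n) (x i - y j)^-1.

(** Eliminating the last row and column of a Cauchy matrix leaves the smaller
    Cauchy matrix, up to a scaling of its rows and columns. *)
Lemma det_cauchy_mx_rec n :
  (forall i j, (i <= n)%N -> (j <= n)%N -> x i - y j != 0) ->
  \det (cauchy_mx n.+1) = (x n - y n)^-1 *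
    \prod_(i < n) ((x i - x n) * (y n - y i) / ((x i - y n) * (x n - y i))) *
    \det (cauchy_mx n).
Proof.
move=> xy; have -> : \det (cauchy_mx n.+1) = \det (cauchy_mx (n + 1)) by rewrite addn1.
set d := (x n - y n)^-1.
have d0 : d != 0 by rewrite invr_eq0 xy.
pose b : 'cV[F]_n := \col_i (x i - y n)^-1.
pose c : 'rV[F]_n := \row_j (x n - y j)^-1.
have -> : cauchy_mx (n + 1) = block_mx (cauchy_mx n) b c d%:M.
  rewrite -[LHS]submxK; congr block_mx; apply/matrixP => i j; rewrite !mxE /=.
  - by [].
  - by rewrite (ord1 j) addn0.
  - by rewrite (ord1 i) addn0.
  - by rewrite (ord1 i) (ord1 j) !addn0 eqxx.
have -> : block_mx (cauchy_mx n) b c d%:M =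
   block_mx 1%:M (d^-1 *: b) 0 1%:M *m
   block_mx (cauchy_mx n - d^-1 *: (b *m c)) 0 c d%:M.
  rewrite mulmx_block !mul1mx !mul0mx ?mulmx0 !add0r ?addr0.
  rewrite -scalemxAl subrK -scalemxAl mul_mx_scalar scalerA mulVf // scale1r //.
rewrite det_mulmx det_ublock det_lblock !det1 !mul1r det_scalar1.
pose f : 'rV[F]_n := \row_i ((x i - x n) / (x i - y n)).
pose g : 'rV[F]_n := \row_j ((y n - y j) / (x n - y j)).
have -> : cauchy_mx n - d^-1 *: (b *m c) = diag_mx f *m cauchy_mx n *m diag_mx g.
  apply/matrixP => i j; rewrite mul_mx_diag mul_diag_mx !mxE big_ord1 !mxE /d invrK.
  have h1 : x i - y j != 0 by apply: xy; exact: ltnW.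
  have h2 : x n - y j != 0 by apply: xy => //; exact: ltnW.
  have h3 : x i - y n != 0 by apply: xy => //; exact: ltnW.
  by field; rewrite h1 h2 h3.
have -> : \prod_(i < n) ((x i - x n) * (y n - y i) / ((x i - y n) * (x n - y i))) =
    (\prod_(i < n) f 0 i) * \prod_(i < n) g 0 i.
  by rewrite -big_split /=; apply: eq_bigr => i _; rewrite !mxE invfM; ring.
by rewrite !det_mulmx !det_diag; ring.
Qed.

End CauchyDeterminant.

Lemma dyadic_prod_ord (R : realType) (u : nat -> R[i]) n :
  dyadic_prod u n = \prod_(i < n) u (i + n.+1)%N.
Proof.
rewrite /dyadic_prod -{1}[n.+1]add0n big_addn.
have -> : (n.*2.+1 - n.+1 = n)%N by rewrite -addnn; lia.
by rewrite big_mkord.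
Qed.

Lemma prod_ord_rev (R : realType) (u : nat -> R[i]) n :
  \prod_(1 <= k < n.+1) u k = \prod_(i < n) u (n - i)%N.
Proof.
rewrite big_nat_rev /= big_add1 big_mkord; apply: eq_bigr => i _.
by congr u; have := ltn_ord i; lia.
Qed.

Section ToeplitzHankel.
Variable R : realType.
Variable beta : R[i].
Hypothesis beta_nonint : forall m : int, beta <> m%:~R.

Let S := sin_over_pi beta.
Let xs (j : nat) : R[i] := (beta - j%:R - 1 / 2) ^+ 2.
Let ys (k : nat) : R[i] := (k%:R + 1 / 2) ^+ 2.

Lemma beta_neq_int (m : int) : beta - m%:~R != 0.
Proof. by rewrite subr_eq0; apply/eqP; exact: beta_nonint. Qed.

Lemma beta_neq_nat (m : nat) : beta - m%:R != 0.
Proof. exact: (beta_neq_int m). Qed.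

Lemma beta_neq_natN (m : nat) : beta + m%:R != 0.
Proof. by have := beta_neq_int (- m%:Z); rewrite mulrNz opprK. Qed.

(** The two Fourier coefficients have opposite signs, and the difference of
    1/(beta - j + k) and 1/(beta - j - k - 1) has the numerator - (2k + 1), which
    does not depend on j. *)
Lemma toeplitz_hankel_entry (n : nat) (j k : 'I_n) :
  toeplitz_hankel (t_shift beta) n j k =
  (-1) ^+ j * (xs j - ys k)^-1 * ((-1) ^+ k * (- (S * (2 * k%:R + 1)))).
Proof.
have nz m : beta != m%:~R by apply/eqP; exact: beta_nonint.
rewrite mxE !fourier_t_shift // -/S.
have u1 : (-1 : R[i]) \is a GRing.unit by rewrite unitfE oppr_eq0 oner_eq0.
have e1 : (-1) ^ (j%:Z - k%:Z) = (-1) ^+ j * (-1) ^+ k :> R[i].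
  rewrite exprzDr // -exprnN; congr (_ * _).
  by rewrite -exprVn invrN1.
have e2 : (-1) ^ (j%:Z + k%:Z + 1) = - ((-1) ^+ j * (-1) ^+ k) :> R[i].
  by rewrite !exprzDr // expr1z mulrN1.
rewrite e1 e2 !rmorphD rmorphN /= -!pmulrn.
have h1 := beta_neq_int (j%:Z - k%:Z); have h2 := beta_neq_nat (j + k + 1).
rewrite rmorphB /= -!pmulrn in h1; rewrite !natrD in h2.
have -> : xs j - ys k = (beta - (j%:R - k%:R)) * (beta - (j%:R + k%:R + 1)).
  by rewrite /xs /ys; field.
move: ((-1) ^+ j) ((-1) ^+ k) h1 h2 => s t; move: (j%:R) (k%:R) S => J K S' h1 h2.
by field; rewrite h1 h2.
Qed.

Lemma xs_ys_neq0 (j k : nat) : xs j - ys k != 0.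
Proof.
have -> : xs j - ys k = (beta - (j%:Z - k%:Z)%:~R) * (beta - (j + k + 1)%:R).
  by rewrite /xs /ys !natrD rmorphB /= -!pmulrn; field.
by rewrite mulf_neq0 ?beta_neq_int ?beta_neq_nat.
Qed.

Lemma det_toeplitz_hankelE n : \det (toeplitz_hankel (t_shift beta) n) =
  \det (cauchy_mx xs ys n) * \prod_(k < n) (- (S * (2 * k%:R + 1))).
Proof.
pose f : 'rV[R[i]]_n := \row_i ((-1) ^+ i).
pose g : 'rV[R[i]]_n := \row_k ((-1) ^+ k * (- (S * (2 * k%:R + 1)))).
have -> : toeplitz_hankel (t_shift beta) n = diag_mx f *m cauchy_mx xs ys n *m diag_mx g.
  apply/matrixP => i j; rewrite toeplitz_hankel_entry mul_mx_diag mul_diag_mx !mxE.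
  by [].
rewrite !det_mulmx !det_diag mulrAC mulrC; congr (_ * _); rewrite -big_split /=.
apply: eq_bigr => k _; rewrite !mxE mulrA -expr2 -exprM mulnC exprM sqrrN expr1n expr1n.
by rewrite mul1r.
Qed.

Definition qfactor (m : nat) : R[i] := 1 + (- beta) / m%:R.

Lemma qfactor_neq0 m : (0 < m)%N -> qfactor m != 0.
Proof.
move=> m0; have mc : (m%:R : R[i]) != 0 by rewrite pnatr_eq0 -lt0n.
have -> : qfactor m = - (beta - m%:R) / m%:R by rewrite /qfactor; field.
by rewrite mulf_neq0 ?invr_eq0 // oppr_eq0 beta_neq_nat.
Qed.

Lemma sine_factor_neq0 m : (0 < m)%N -> 1 + - (beta ^+ 2 / m%:R ^+ 2) != 0.
Proof.
move=> m0; have mc : (m%:R : R[i]) != 0 by rewrite pnatr_eq0 -lt0n.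
have -> : 1 + - (beta ^+ 2 / m%:R ^+ 2) = - ((beta - m%:R) * (beta + m%:R)) / m%:R ^+ 2.
  by field.
by rewrite mulf_neq0 ?invr_eq0 ?expf_neq0 // oppr_eq0 mulf_neq0 ?beta_neq_nat ?beta_neq_natN.
Qed.

Definition double_factor (m : nat) : R[i] := 1 + (- 2 * beta) / m%:R.

Definition det_ratio n := S / beta / \prod_(1 <= m < n.+1) (1 + - (beta ^+ 2 / m%:R ^+ 2))
   * (dyadic_prod double_factor n / dyadic_prod qfactor n ^+ 2 / qfactor n.*2.+1).

Lemma det_toeplitz_hankel_rec n : \det (toeplitz_hankel (t_shift beta) n.+1) =
  det_ratio n * \det (toeplitz_hankel (t_shift beta) n).
Proof.
rewrite !det_toeplitz_hankelE det_cauchy_mx_rec; last by move=> *; exact: xs_ys_neq0.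
rewrite big_ord_recr /=; set C := \det _; set P := \prod_(i < n) - _.
have b0 : beta != 0 by have := beta_neq_nat 0; rewrite subr0.
have e1 : \prod_(i < n) ((xs i - xs n) * (ys n - ys i) / ((xs i - ys n) * (xs n - ys i)))
  = (\prod_(1 <= m < n.+1) (1 + - (beta ^+ 2 / m%:R ^+ 2)))^-1 *
    (dyadic_prod double_factor n / dyadic_prod qfactor n ^+ 2).
  rewrite !dyadic_prod_ord prod_ord_rev -prodfV -prodrXl -prodfV -!big_split /=.
  apply: eq_bigr => i _.
  have -> : ((n - i)%:R = n%:R - i%:R :> R[i]) by rewrite natrB // ltnW.
  have ni : (0 < n - i)%N by rewrite subn_gt0.
  have m0 : (0 < i + n.+1)%N by rewrite addnS.
  have h1 := sine_factor_neq0 ni; have h2 := qfactor_neq0 m0.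
  have c1 : (n%:R - i%:R : R[i]) != 0 by rewrite -natrB ?pnatr_eq0 -?lt0n // ltnW.
  have c2 : (i%:R + n%:R + 1 : R[i]) != 0 by rewrite -natrD natr1 pnatr_eq0.
  have c3 := beta_neq_nat (n - i); have c4 := beta_neq_natN (n - i).
  have c5 := beta_neq_nat (i + n.+1).
  rewrite natrB ?(ltnW (ltn_ord i)) // in c3 c4.
  have e : (i + n.+1)%:R = i%:R + n%:R + 1 :> R[i] by rewrite addnS -addn1 !natrD.
  rewrite e in c5; rewrite /qfactor /double_factor /xs /ys e.
  move: c1 c2 c3 c4 c5; move: (i%:R) (n%:R) => I N c1 c2 c3 c4 c5.
  field; apply/and5P; split=> //.
  - by have -> : I + N + 1 - beta = - (beta - (I + N + 1)); [ring|rewrite oppr_eq0].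
  - have -> : (N - I) ^+ 2 - beta ^+ 2 = - ((beta - (N - I)) * (beta + (N - I))) by ring.
    by rewrite oppr_eq0 mulf_neq0.
  have n4 : (4 : R[i]) != 0 by rewrite pnatr_eq0.
  apply/andP; split.
  - have -> : ((beta - N) * 2 - 1) ^+ 2 - (I * 2 + 1) ^+ 2 =
      4 * ((beta - (I + N + 1)) * (beta - (N - I))) by ring.
    by rewrite !mulf_neq0.
  - have -> : ((beta - I) * 2 - 1) ^+ 2 - (N * 2 + 1) ^+ 2 =
      4 * ((beta - (I + N + 1)) * (beta + (N - I))) by ring.
    by rewrite !mulf_neq0.
rewrite e1 /det_ratio.
have q0 := @qfactor_neq0 n.*2.+1 isT.
have d0 : dyadic_prod qfactor n != 0.
  by rewrite dyadic_prod_ord; apply/prodf_neq0 => i _; apply: qfactor_neq0; rewrite addnS.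
have s0 : \prod_(1 <= m < n.+1) (1 + - (beta ^+ 2 / m%:R ^+ 2)) != 0.
  by apply: prod_nat_neq0; exact: sine_factor_neq0.
have xn : xs n - ys n = - beta * (2 * n%:R + 1) * qfactor n.*2.+1.
  have nn : (2 * n%:R + 1 : R[i]) != 0 by rewrite -natrM natr1 pnatr_eq0.
  have -> : qfactor n.*2.+1 = 1 + - beta / (2 * n%:R + 1).
    by rewrite /qfactor -natr1 -mul2n natrM.
  by rewrite /xs /ys; field.
have nn : (2 * n%:R + 1 : R[i]) != 0 by rewrite -natrM natr1 pnatr_eq0.
rewrite xn; move: q0 d0 s0 nn.
move: (qfactor _) (dyadic_prod qfactor n) (dyadic_prod _ n) (\prod_(1 <= m < n.+1) _) => q d d' s.
move: S C P => S' C' P' q0 d0 s0 nn.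
by field; rewrite q0 d0 s0 nn b0.
Qed.

Lemma beta_neq0 : beta != 0.
Proof. by have := beta_neq_nat 0; rewrite subr0. Qed.

(** Euler's product converges to a nonzero limit since no factor vanishes. *)
Lemma sin_over_pi_neq0 : sin_over_pi beta != 0.
Proof.
have h : \forall k \near \oo, normc (1 + - (beta ^+ 2 / k%:R ^+ 2) - 1) <=
    normc beta ^+ 2 * k%:R^-1 ^+ 2.
  apply: nearW => k; rewrite addrAC subrr add0r normcN.
  by rewrite -exprVn Normc.normcM !normcX normc_inv_nat.
have := prod_ccvg_neq0 h sine_factor_neq0 (sine_product beta_neq0).
by rewrite mulf_eq0 negb_or => /andP[].
Qed.

Lemma double_factor_eq0 m : (0 < m)%N -> (double_factor m == 0) = (2 * beta == m%:R).
Proof.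
move=> m0; have mc : (m%:R : R[i]) != 0 by rewrite pnatr_eq0 -lt0n.
have -> : double_factor m = (m%:R - 2 * beta) / m%:R by rewrite /double_factor; field.
by rewrite mulf_eq0 invr_eq0 (negbTE mc) orbF subr_eq0 eq_sym.
Qed.

Lemma det_toeplitz_hankel_eq0 n : (\det (toeplitz_hankel (t_shift beta) n) == 0) =
  has (fun k => dyadic_prod double_factor k == 0) (iota 0 n).
Proof.
elim: n => [|n IH]; first by rewrite det_mx00 oner_eq0.
rewrite det_toeplitz_hankel_rec mulf_eq0 IH -addn1 iotaD has_cat /= orbF orbC.
congr (_ || _); rewrite /det_ratio /S.
move: (sin_over_pi beta) sin_over_pi_neq0 => s s0.
rewrite !mulf_eq0 !invr_eq0 (negbTE s0) (negbTE beta_neq0) /=.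
rewrite (negbTE (prod_nat_neq0 _ sine_factor_neq0)) /=.
rewrite (negbTE (qfactor_neq0 (ltn0Sn _))) orbF sqrf_eq0.
have -> : (dyadic_prod qfactor n == 0) = false; last by rewrite orbF.
by apply/negbTE; rewrite dyadic_prod_ord; apply/prodf_neq0 => i _; apply: qfactor_neq0; rewrite addnS.
Qed.

(** Twice beta is never an even integer, so the zero factors have odd index. *)
Lemma det_toeplitz_hankel_zeros n :
  \det (toeplitz_hankel (t_shift beta) n) = 0 <-> det_zeros n beta.
Proof.
have two0 : (2 : R[i]) != 0 by rewrite pnatr_eq0.
have e2 (m : nat) : m%:R + 1 / 2 = beta <-> 2 * beta = m.*2.+1%:R.
  have -> : m.*2.+1%:R = 2 * m%:R + 1 :> R[i] by rewrite -natr1 -mul2n natrM.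
  split=> [<-|h]; first by field.
  apply: (mulfI two0); rewrite h; by field.
split=> [/eqP|[m [m1 mn] /e2 hm]].
  rewrite det_toeplitz_hankel_eq0 => /hasP[k]; rewrite mem_iota add0n => /= kn.
  rewrite dyadic_prod_ord => /prodf_eq0[i _].
  rewrite double_factor_eq0 ?addnS // => /eqP.
  have ik := ltn_ord i.
  have := odd_double_half (i + k).+1.
  move: (odd _) (_./2) => [] m /= em; rewrite -em => h.
    by exists m; [split=> //; move: em; rewrite -addnn; lia|apply/e2; rewrite h add1n].
  have := beta_neq_nat m; rewrite subr_eq0 => /eqP[].
  by apply: (mulfI two0); rewrite h add0n -mul2n natrM.
apply/eqP; rewrite det_toeplitz_hankel_eq0; apply/hasP; exists m.+1.
  by rewrite mem_iota add0n /=; lia.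
have mm : (m.-1 < m.+1)%N by lia.
rewrite dyadic_prod_ord; apply/prodf_eq0; exists (Ordinal mm) => //=.
have -> : (m.-1 + m.+2 = m.*2.+1)%N by rewrite -addnn; lia.
by rewrite double_factor_eq0 // hm.
Qed.

End ToeplitzHankel.

(** * Rearranging the products by exponent *)

Section DoublingProducts.
Variable R : realType.
Implicit Types u : nat -> R[i].

Definition weighted_prod u N := \prod_(1 <= m < N.+1) u m ^+ m.

(** The product over l < h of the products of u over ]l, 2l] and ]l, 2l + 1]. It
    occurs in the denominator of the determinant with u = q, and in its numerator
    with u = q and u = w. *)
Definition block_prod u h := \prod_(0 <= l < h) (dyadic_prod u l ^+ 2 * u l.*2.+1).

Lemma dyadic_prodS u h : u h.+1 != 0 ->
  dyadic_prod u h.+1 = dyadic_prod u h * u h.*2.+1 * u h.*2.+2 / u h.+1.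
Proof.
move=> u0; have h1 : dyadic_prod u h * u h.*2.+1 * u h.*2.+2 = u h.+1 * dyadic_prod u h.+1.
  rewrite /dyadic_prod doubleS -(big_ltn _ (n := h.*2.+3) (m := h.+1)); last by rewrite -addnn; lia.
  rewrite [RHS]big_nat_recr /=; last by rewrite -addnn; lia.
  by rewrite [X in _ = X * _]big_nat_recr //=; rewrite -addnn; lia.
by rewrite h1 mulrC mulKf.
Qed.

(** The index m <= h occurs m times, and h < m <= 2h occurs 2h - m times. *)
Lemma block_prod_closed u h : (forall k, (0 < k)%N -> u k != 0) ->
  block_prod u h = weighted_prod u h ^+ 2 / weighted_prod u h.*2 * dyadic_prod u h ^+ h.*2.
Proof.
move=> u0; elim: h => [|h IH].
  by rewrite /block_prod /weighted_prod !big_geq // expr0 expr1n invr1 !mulr1.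
rewrite /block_prod big_nat_recr //= -/(block_prod u h) IH dyadic_prodS ?u0 // /weighted_prod.
rewrite doubleS !(big_nat_recr _.+1) //= -/(weighted_prod u h) -/(weighted_prod u h.*2).
have Q0 : weighted_prod u h.*2 != 0.
  by apply: prod_nat_neq0 => k k0; rewrite expf_neq0 // u0.
rewrite !exprMn exprVn -exprM muln2 doubleS.
have a0 : u h.+1 ^+ h.*2.+2 != 0 by rewrite expf_neq0 // u0.
have b0 : u h.*2.+1 ^+ h.*2.+1 != 0 by rewrite expf_neq0 // u0.
have c0 : u h.*2.+2 ^+ h.*2.+2 != 0 by rewrite expf_neq0 // u0.
rewrite [u h.*2.+1 ^+ h.*2.+2]exprS [dyadic_prod u h ^+ h.*2.+2]exprS [dyadic_prod u h ^+ h.*2.+1]exprS.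
move: a0 b0 c0 Q0.
move: (u h.+1 ^+ _) (u h.*2.+1 ^+ _) (u h.*2.+2 ^+ _) => a b c.
move: (weighted_prod u h.*2) (weighted_prod u h) (dyadic_prod u h) (_ ^+ h.*2) (u _) => Q P d D e.
by move=> a0 b0 c0 Q0; field; rewrite a0 b0 c0 Q0.
Qed.

(** The index m occurs in the factors with m <= k < n, hence n - m times. *)
Lemma prod_tails_closed u (l : R[i]) n : (forall k, (0 < k)%N -> u k != 0) ->
  \prod_(0 <= k < n) (l / \prod_(1 <= m < k.+1) u m) =
  (l / \prod_(1 <= m < n.+1) u m) ^+ n * weighted_prod u n.
Proof.
move=> u0; elim: n => [|n IH].
  by rewrite /weighted_prod !big_geq // expr0 mulr1.
rewrite big_nat_recr //= IH /weighted_prod !(big_nat_recr n.+1) //= -/(weighted_prod u n).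
have p0 := prod_nat_neq0 n u0; have un := u0 n.+1 isT.
have un1 : u n.+1 ^+ n.+1 != 0 by rewrite expf_neq0.
rewrite [l / (_ * _)](_ : _ = (l / \prod_(1 <= m < n.+1) u m) / u n.+1); last by rewrite invfM mulrA.
rewrite [in RHS]exprMn exprVn exprSr.
move: un1; move: (u n.+1 ^+ _) (weighted_prod u n) (l / _) => a W L a0.
by field.
Qed.

Let recr (F : nat -> R[i]) (m n : nat) : (m <= n)%N ->
  \prod_(m <= i < n.+1) F i = (\prod_(m <= i < n) F i) * F n.
Proof. exact: big_nat_recr. Qed.

Lemma prod_even_odd u a d :
  \prod_(a.*2.+1 <= m < (a + d).*2.+1) u m =
  \prod_(a.+1 <= j < (a + d).+1) u j.*2 * \prod_(a <= j < a + d) u j.*2.+1.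
Proof.
elim: d => [|d IH]; first by rewrite addn0 !big_geq // mulr1.
rewrite addnS doubleS (recr _ (n := (a + d).*2.+2)); last by rewrite -!addnn; lia.
rewrite (recr _ (n := (a + d).*2.+1)) ?ltnS ?leq_double ?leq_addr // IH.
rewrite (recr _ (n := (a + d).+1)) ?ltnS ?leq_addr // [X in _ = _ * X](recr _ (n := (a + d)%N)) ?leq_addr //.
by rewrite doubleS; ring.
Qed.

Lemma prod_even_odd' u a d :
  \prod_(a.*2.+2 <= m < (a + d).*2.+3) u m =
  \prod_(a.+1 <= j < (a + d).+2) u j.*2 * \prod_(a.+1 <= j < (a + d).+1) u j.*2.+1.
Proof.
elim: d => [|d IH].
  by rewrite addn0 !big_nat1 big_geq // mulr1 doubleS.
rewrite addnS doubleS (recr _ (n := (a + d).*2.+4)); last by rewrite -!addnn; lia.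
rewrite (recr _ (n := (a + d).*2.+3)); last by rewrite -!addnn; lia.
rewrite IH (recr _ (n := (a + d).+2)); last by lia.
rewrite [X in _ = _ * X](recr _ (n := (a + d).+1)) ?ltnS ?leq_addr //.
by rewrite !doubleS; ring.
Qed.

(** Splitting m into even and odd values turns the products over dyadic blocks
    of u into those of its two subsequences. *)
Lemma prod_dyadic_prod_split u h :
  \prod_(0 <= k < h.+1.*2) dyadic_prod u k =
  block_prod (fun j => u j.*2) h.+1 *
  (block_prod (fun j => u j.*2.+1) h * dyadic_prod (fun j => u j.*2.+1) h).
Proof.
pose q j := u j.*2; pose w j := u j.*2.+1.
have even l : dyadic_prod u l.*2 = dyadic_prod q l * \prod_(l <= j < l.*2) w j.
  by rewrite /dyadic_prod; have := prod_even_odd u l l; rewrite !addnn.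
have odd l : dyadic_prod u l.*2.+1 = dyadic_prod q l * q l.*2.+1 * dyadic_prod w l.
  rewrite /dyadic_prod -big_nat_recr /=; last by rewrite -addnn; lia.
  by have := prod_even_odd' u l l; rewrite !addnn doubleS.
elim: h => [|h IH].
  rewrite /block_prod doubleS double0 !big_nat_recr //= !big_geq // !mul1r (even 0%N) (odd 0%N).
  rewrite /dyadic_prod !big_geq //= expr1n !mul1r !mulr1 //.
rewrite doubleS (recr _ (n := h.+1.*2.+1)) // (recr _ (n := h.+1.*2)) // IH even odd.
have BS v k : block_prod v k.+1 = block_prod v k * (dyadic_prod v k ^+ 2 * v k.*2.+1).
  by rewrite /block_prod (recr _ (n := k)).
rewrite -/q -/w (BS q h.+1) (BS w h).
have -> : \prod_(h.+1 <= j < h.+1.*2) w j = dyadic_prod w h * w h.*2.+1.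
  by rewrite /dyadic_prod doubleS big_nat_recr //= -addnn; lia.
by ring.
Qed.

End DoublingProducts.

(** * Asymptotics *)

Section Assembly.
Variable R : realType.
Local Notation lnc x := ((ln x : R)%:C).

Lemma lnc_double n : (0 < n)%N -> lnc (n.*2)%:R = lnc n%:R + lnc 2.
Proof.
by move=> n0; rewrite -(ln_double R n0) -rmorphD addrC subrK.
Qed.

Lemma leq_double_self n : (n <= n.*2)%N.
Proof. by rewrite -addnn leq_addr. Qed.

(** In P_h^2 / P_2h the terms linear in h of the exponents cancel, and s ln h
    remains once; the dyadic product contributes 2^(2ah) and the constant
    exp(c). *)
Lemma block_prod_ccvg (u : nat -> R[i]) a b s p :
  (forall k, (0 < k)%N -> u k != 0) -> expand2 u a b -> p != 0 ->
  ccvg (fun N => weighted_prod u N * cexp (- (s * lnc N%:R + a * N%:R))) p ->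
  ccvg (fun h => block_prod u h *
      cexp (- (s * (lnc h%:R - lnc 2) + h.*2%:R * (a * lnc 2))))
    (p * cexp (prod_exponent a b)).
Proof.
move=> u0 hu p0 hp.
have hp2 := ccvg_comp leq_double_self hp.
have := ccvgM (ccvgM (@ccvgX _ _ _ 2 hp) (ccvgV p0 hp2)) (dyadic_prod_pow_ccvg hu).
have -> : p ^+ 2 / p = p by rewrite expr2 mulfK.
apply: ccvg_near; near=> h.
have h0 : (0 < h)%N by near: h; exact: nbhs_infty_gt.
rewrite (block_prod_closed _ u0) lnc_double //.
have Q0 : weighted_prod u h.*2 != 0.
  by apply: prod_nat_neq0 => k k0; rewrite expf_neq0 // u0.
set X := cexp (- (s * lnc h%:R + _)); set Y := cexp (- (s * (_ + _) + a * _)).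
set E := cexp (- (h.*2%:R * _)); set T := cexp (- (s * (_ - _) + _)).
have : T * Y = X ^+ 2 * E.
  rewrite /X /Y /E /T expr2 -!cexpD; congr cexp.
  by rewrite -muln2 natrM; ring.
have := cexp_neq0 (- (s * (lnc h%:R + lnc 2) + a * h.*2%:R)); rewrite -/Y.
move: X Y E T (weighted_prod u h) (weighted_prod u _) Q0 => X Y E T P Q Q0 Y0 e.
move: (_ ^+ h.*2) => D.
rewrite exprMn invfM.
have -> : P ^+ 2 * X ^+ 2 * (Q^-1 / Y) * (D * E) = P ^+ 2 / Q * D * (X ^+ 2 * E / Y).
  by field; rewrite Q0 Y0.
by rewrite -e mulfK.
Unshelve. all: by end_near. Qed.

Variable beta : R[i].
Hypothesis beta_nonint : forall m : int, beta <> m%:~R.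

Let w (j : nat) : R[i] := double_factor beta j.*2.+1.
Let q : nat -> R[i] := qfactor beta.

(** The weighted product of 1 - beta^2 / m^2 splits into those of 1 + beta / m and
    1 - beta / m; the tail of Euler's product gives exp(- beta^2). *)
Lemma prefactor_ccvg :
  ccvg (fun n => \prod_(0 <= k < n)
      (sin_over_pi beta / beta / \prod_(1 <= m < k.+1) (1 + - (beta ^+ 2 / m%:R ^+ 2))) *
      cexp (beta ^+ 2 * lnc n%:R))
    (cexp (- beta ^+ 2) * (barnes_core beta * barnes_core (- beta))).
Proof.
have sf := sine_factor_neq0 beta_nonint.
have hu : expand2 (fun m => 1 + - (beta ^+ 2 / m%:R ^+ 2)) 0 (- beta ^+ 2).
  exists 0; apply: nearW => m; rewrite mul0r.
  by rewrite (_ : _ - _ = 0) ?Normc.normc0 // exprVn; ring.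
have h1 := tail_pow_ccvg hu sf (sine_product (beta_neq0 beta_nonint)).
have := ccvgM h1 (ccvgM (@barnes_core_ccvg _ beta) (@barnes_core_ccvg _ (- beta))).
apply: ccvg_near; apply: nearW => n.
have -> : cexp (beta ^+ 2 * lnc n%:R) =
    cexp (beta ^+ 2 / 2 * lnc n%:R - beta * n%:R) *
    cexp ((- beta) ^+ 2 / 2 * lnc n%:R - - beta * n%:R).
  by rewrite -cexpD; congr cexp; field.
rewrite (prod_tails_closed _ _ sf).
rewrite [weighted_prod _ n](_ : _ = \prod_(1 <= k < n.+1) (1 + beta / k%:R) ^+ k *
    \prod_(1 <= k < n.+1) (1 + - beta / k%:R) ^+ k); first by ring.
rewrite -big_split /=; apply: eq_big_nat => k /andP[k0 _]; rewrite -exprMn; congr (_ ^+ _).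
have kc : (k%:R : R[i]) != 0 by rewrite pnatr_eq0 -lt0n.
by field.
Qed.

Lemma qfactor_expand : expand2 q (- beta) 0.
Proof. exact: expand2_affine. Qed.

Lemma double_odd_expand : expand2 w (- beta) (beta / 2).
Proof.
exists (normc beta); near=> m.
have m0 : (0 : R) < m%:R by rewrite ltr0n; near: m; exact: nbhs_infty_gt.
have mc : (m%:R : R[i]) != 0 by rewrite pnatr_eq0 -lt0n -(ltr0n R).
have m2 : (2 * m%:R + 1 : R[i]) != 0 by rewrite -natrM natr1 pnatr_eq0.
have e : m.*2.+1%:R = 2 * m%:R + 1 :> R[i] by rewrite -natr1 -mul2n natrM.
have -> : w m - (1 + - beta * m%:R^-1 + beta / 2 * m%:R^-1 ^+ 2) =
    - (beta * (m%:R^-1 ^+ 2 * (2 * (2 * m%:R + 1))^-1)).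
  by rewrite /w /double_factor e; field; rewrite m2 mc.
rewrite normcN Normc.normcM; apply: ler_wpM2l; first exact: normc_ge0.
rewrite (Normc.normcM (m%:R^-1 ^+ 2)) normcX normc_inv_nat [X in _ <= X]exprSr.
apply: ler_wpM2l; first by rewrite exprn_ge0 // invr_ge0 ltW.
rewrite Normc.normcV -natrM natr1 -natrM normc_nat.
by rewrite lef_pV2 ?posrE // ?ltr0n // ler_nat; lia.
Unshelve. all: by end_near. Qed.

Lemma core_neq0 (z : R[i]) : (forall k, (0 < k)%N -> 1 + z / k%:R != 0) -> barnes_core z != 0.
Proof.
by move=> h; rewrite mulf_neq0 ?cexp_neq0 // barnes_prod_neq0.
Qed.

(** The odd factors w relate the Barnes products at 1/2 - beta and 1/2. *)
Lemma half_shift_factor k : (0 < k)%N ->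
  1 + (1 / 2 - beta) / k%:R = w k * (1 + 1 / 2 / k%:R).
Proof.
move=> k0; have kc : (k%:R : R[i]) != 0 by rewrite pnatr_eq0 -lt0n.
have m2 : (2 * k%:R + 1 : R[i]) != 0 by rewrite -natrM natr1 pnatr_eq0.
have e : k.*2.+1%:R = 2 * k%:R + 1 :> R[i] by rewrite -natr1 -mul2n natrM.
by rewrite /w /double_factor e; field; rewrite m2 kc.
Qed.

Lemma half_factor_neq0 k : (0 < k)%N -> 1 + 1 / 2 / k%:R != 0 :> R[i].
Proof.
move=> k0; have -> : 1 + 1 / 2 / k%:R = (2 * k%:R + 1) / (2 * k%:R) :> R[i].
  by field; rewrite pnatr_eq0 -lt0n.
by rewrite -natrM natr1 mulf_neq0 // ?pnatr_eq0 // invr_eq0 pnatr_eq0 muln_eq0 /= -lt0n.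
Qed.

Lemma core_half_neq0 : barnes_core (1 / 2 : R[i]) != 0.
Proof. by apply: core_neq0; exact: half_factor_neq0. Qed.

Let s2 : R[i] := (beta - beta ^+ 2) / 2.

Lemma weighted_double_odd_ccvg :
  ccvg (fun N => weighted_prod w N * cexp (- (s2 * lnc N%:R + - beta * N%:R)))
    (barnes_core (1 / 2 - beta) / barnes_core (1 / 2)).
Proof.
have := ccvgM (@barnes_core_ccvg _ (1 / 2 - beta))
  (ccvgV core_half_neq0 (@barnes_core_ccvg _ (1 / 2))).
apply: ccvg_near; apply: nearW => N.
have -> : \prod_(1 <= k < N.+1) (1 + (1 / 2 - beta) / k%:R) ^+ k =
    weighted_prod w N * \prod_(1 <= k < N.+1) (1 + 1 / 2 / k%:R) ^+ k.
  rewrite -big_split /=; apply: eq_big_nat => k /andP[k0 _].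
  by rewrite half_shift_factor // exprMn.
have P0 : \prod_(1 <= k < N.+1) (1 + 1 / 2 / k%:R) ^+ k != 0 :> R[i].
  by apply: prod_nat_neq0 => k k0; rewrite expf_neq0 // half_factor_neq0.
set X := cexp (_ - _); set Y := cexp (_ - _); set Z := cexp (- _).
have e : Z * Y = X.
  by rewrite /X /Y /Z -cexpD; congr cexp; rewrite /s2; field.
have Y0 : Y != 0 by exact: cexp_neq0.
move: e P0 Y0; move: X Y Z (weighted_prod _ _) (\prod_(_ <= _ < _) _) => X Y Z W P <- P0 Y0.
by field; rewrite P0 Y0.
Qed.

Lemma weighted_qfactor_ccvg :
  ccvg (fun N => weighted_prod q N * cexp (- (- (beta ^+ 2 / 2) * lnc N%:R + - beta * N%:R)))
    (barnes_core (- beta)).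
Proof.
apply: ccvg_near (@barnes_core_ccvg _ (- beta)); apply: nearW => N.
by rewrite /weighted_prod /q /qfactor; congr (_ * cexp _); ring.
Qed.

Lemma expand2_ccvg (u : nat -> R[i]) a b : expand2 u a b -> ccvg u 1.
Proof.
move=> [K hK]; have [B hB] := poly_bounded a b.
apply: (@ccvg_bound _ (`|K| + B)); near=> m.
have /andP[t0 t1] : 0 < (m%:R^-1 : R) <= 1 by near: m; exact: near_inv_le1.
have -> : u m - 1 = (u m - (1 + a * m%:R^-1 + b * m%:R^-1 ^+ 2)) + m%:R^-1 * (a + b * m%:R^-1).
  by move: (m%:R^-1) => x; ring.
apply: le_trans (le_normcD _ _) _; rewrite mulrDl; apply: lerD.
  apply: (@le_trans _ _ (K * m%:R^-1 ^+ 3)); first by near: m.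
  apply: (@le_trans _ _ (`|K| * m%:R^-1 ^+ 3)).
    by apply: ler_wpM2r; rewrite ?ler_norm // exprn_ge0 // ltW.
  by apply: ler_wpM2l => //; rewrite exprSr ler_piMl ?exprn_ile1 // ltW.
rewrite Normc.normcM normc_inv_nat mulrC; apply: ler_wpM2r; first exact: ltW.
by near: m.
Unshelve. all: by end_near. Qed.

Lemma ln_succ_ccvg0 : ccvg (fun n => lnc n%:R - lnc n.+1%:R) 0.
Proof.
have h : expand2 (fun m => 1 + (ln m%:R - ln m.-1%:R : R)%:C) 1 2^-1.
  apply: Ocube_eq (ln_step_expand R); apply: nearW => m.
  by move: (m%:R^-1) (_%:C) => x y; ring.
have := ccvgB (@ccvg_cst R 1) (@ccvg_comp _ S _ _ leqnSn (expand2_ccvg h)).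
rewrite subrr; apply: ccvg_near; apply: nearW => n.
by rewrite /= rmorphB; ring.
Qed.

Lemma ccvg_shiftS (u : nat -> R[i]) l : ccvg (fun n => u n.+1) l -> ccvg u l.
Proof. by move=> /ccvgP h; apply/ccvgP => e /h; exact: near_inftyS. Qed.

Lemma double_factor_even j : double_factor beta j.*2 = q j.
Proof.
rewrite /double_factor /q /qfactor -mul2n natrM invfM; congr (1 + _).
by move: (j%:R^-1) => x; field.
Qed.

Lemma det_toeplitz_hankel_prod n : \det (toeplitz_hankel (t_shift beta) n) =
  \prod_(0 <= k < n) det_ratio beta k.
Proof.
elim: n => [|n IH]; first by rewrite det_mx00 big_geq.
by rewrite det_toeplitz_hankel_rec // big_nat_recr //= IH mulrC.
Qed.

Lemma det_toeplitz_hankel_even h :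
  \det (toeplitz_hankel (t_shift beta) h.+1.*2) =
  \prod_(0 <= k < h.+1.*2)
      (sin_over_pi beta / beta / \prod_(1 <= m < k.+1) (1 + - (beta ^+ 2 / m%:R ^+ 2))) *
  (block_prod q h.+1 * (block_prod w h * dyadic_prod w h) / block_prod q h.+1.*2).
Proof.
rewrite det_toeplitz_hankel_prod /det_ratio big_split /=; congr (_ * _).
have -> : block_prod q h.+1 * (block_prod w h * dyadic_prod w h) =
    \prod_(0 <= k < h.+1.*2) dyadic_prod (double_factor beta) k.
  rewrite prod_dyadic_prod_split; congr (block_prod _ _ * _).
  by apply/funext => j; rewrite double_factor_even.
rewrite /block_prod -prodfV -big_split /=; apply: eq_bigr => k _.
by rewrite [in RHS]invfM [in RHS]mulrA.
Qed.

Definition det_exponent : R[i] := - (3 * beta ^+ 2 / 2) + beta / 2.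

Definition det_constant : R[i] :=
  cexp (- beta ^+ 2) * (barnes_core beta * barnes_core (- beta)) *
  (barnes_core (1 / 2 - beta) / barnes_core (1 / 2)) *
  cexp (beta - beta ^+ 2 / 2) * cexp (3 * beta ^+ 2 / 2 * lnc 2).

Hypothesis w_neq0 : forall j, (0 < j)%N -> w j != 0.

Lemma core_neg_neq0 : barnes_core (- beta) != 0.
Proof. by apply: core_neq0 => k k0; exact: (qfactor_neq0 beta_nonint). Qed.

Lemma core_pos_neq0 : barnes_core beta != 0.
Proof.
apply: core_neq0 => k k0; have kc : (k%:R : R[i]) != 0 by rewrite pnatr_eq0 -lt0n.
have -> : 1 + beta / k%:R = (beta + k%:R) / k%:R by field.
by rewrite mulf_neq0 ?invr_eq0 // beta_neq_natN.
Qed.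

Lemma core_half_sub_neq0 : barnes_core (1 / 2 - beta) != 0.
Proof.
apply: core_neq0 => k k0.
by rewrite half_shift_factor // mulf_neq0 ?w_neq0 // half_factor_neq0.
Qed.

(** The product of the limits of all parts. The exponents of h and of 2 are
    collected in one exponential at the end. *)
Lemma det_even_ccvg :
  ccvg (fun n => \det (toeplitz_hankel (t_shift beta) n.*2) *
                 cexp (- (det_exponent * lnc n.*2%:R))) det_constant.
Proof.
apply: ccvg_shiftS.
have hq := block_prod_ccvg (qfactor_neq0 beta_nonint) qfactor_expand core_neg_neq0 weighted_qfactor_ccvg.
have p0 : barnes_core (1 / 2 - beta) / barnes_core (1 / 2) != 0.
  by rewrite mulf_neq0 ?invr_eq0 ?core_half_sub_neq0 ?core_half_neq0.
have hw := block_prod_ccvg w_neq0 double_odd_expand p0 weighted_double_odd_ccvg.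
have c0 : barnes_core (- beta) * cexp (prod_exponent (- beta) 0) != 0.
  by rewrite mulf_neq0 ?cexp_neq0 ?core_neg_neq0.
have leq2 n : (n <= n.+1.*2)%N by rewrite -addnn; lia.
have H1 := @ccvg_comp _ (fun n => n.+1.*2) _ _ leq2 prefactor_ccvg.
have H2 := @ccvg_comp _ (fun n => n.+1) _ _ leqnSn hq.
have H3 := ccvgV c0 (@ccvg_comp _ (fun n => n.+1.*2) _ _ leq2 hq).
have H5 := dyadic_prod_ccvg double_odd_expand.
(* H6 replaces ln h by ln (h + 1); H7 collects the remaining powers of 2. *)
have H6 := ccvg_cexp (ccvgM (@ccvg_cst R s2) ln_succ_ccvg0).
have H7 := @ccvg_cst R (cexp ((3 * beta ^+ 2 / 2 + beta) * lnc 2)).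
rewrite mulr0 cexp0 in H6.
have H23 := ccvgM H2 H3; rewrite (divff c0) in H23.
have := ccvgM (ccvgM (ccvgM H1 H23) (ccvgM hw H5)) (ccvgM H6 H7).
rewrite [X in ccvg _ X](_ : _ = det_constant); last first.
  rewrite mulr1 (mul1r (cexp _)) /det_constant.
  have -> : prod_exponent (- beta) (beta / 2) = beta - beta ^+ 2 / 2.
    by rewrite /prod_exponent; field.
  have <- : cexp (- beta * lnc 2) * cexp ((3 * beta ^+ 2 / 2 + beta) * lnc 2) =
     cexp (3 * beta ^+ 2 / 2 * lnc 2) by rewrite -cexpD; congr cexp; ring.
  by ring.
apply: ccvg_near; near=> h.
have h0 : (0 < h)%N by near: h; exact: nbhs_infty_gt.
rewrite det_toeplitz_hankel_even.
have q0 : block_prod q h.+1.*2 != 0.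
  rewrite (block_prod_closed _ (qfactor_neq0 beta_nonint)) mulf_neq0 //.
    rewrite mulf_neq0 ?invr_eq0 ?expf_neq0 //; apply: prod_nat_neq0 => k k0; rewrite expf_neq0 //; exact: (qfactor_neq0 beta_nonint).
  rewrite expf_neq0 // dyadic_prod_ord; apply/prodf_neq0 => i _; apply: (qfactor_neq0 beta_nonint); by rewrite addnS.
move: (\prod_(0 <= k < h.+1.*2) _) (block_prod q h.+1) (block_prod q h.+1.*2) (block_prod w h) (dyadic_prod w h) q0.
move=> A B1 B2 W D B20.
rewrite invfM -cexpN.
set E1 := cexp (beta ^+ 2 * _); set E2 := cexp (- (- (beta ^+ 2 / 2) * _ + _)).
set E3 := cexp (- - _); set E4 := cexp (- (s2 * _ + _)); set E6 := cexp (s2 * _).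
set E7 := cexp ((_ + beta) * _); set E := cexp (- (det_exponent * _)).
have <- : E1 * E2 * E3 * E4 * E6 * E7 = E.
  rewrite /E1 /E2 /E3 /E4 /E6 /E7 /E -!cexpD; congr cexp.
  rewrite !lnc_double // /det_exponent /s2 -!muln2 !natrM -natr1.
  by field.
by field.
Unshelve. all: by end_near. Qed.

Lemma det_ratio_ccvg1 : ccvg (det_ratio beta) 1.
Proof.
have b0 := beta_neq0 beta_nonint.
have S0 : sin_over_pi beta / beta != 0 by rewrite mulf_neq0 ?invr_eq0 ?sin_over_pi_neq0.
have H1 := ccvgM (@ccvg_cst R (sin_over_pi beta / beta)) (ccvgV S0 (sine_product b0)).
rewrite (divff S0) in H1.
have H2 := dyadic_prod_ccvg (expand2_affine (- 2 * beta)).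
have H3 := ccvgV (expf_neq0 2 (cexp_neq0 _)) (ccvgX (k := 2) (dyadic_prod_ccvg qfactor_expand)).
have leq2 n : (n <= n.*2.+1)%N by rewrite -addnn; lia.
have H4 := ccvgV (oner_neq0 _) (@ccvg_comp _ (fun n => n.*2.+1) _ _ leq2 (expand2_ccvg qfactor_expand)).
have := ccvgM H1 (ccvgM (ccvgM H2 H3) H4).
suff e : cexp (- 2 * beta * lnc 2) = cexp (- beta * lnc 2) ^+ 2.
  by rewrite e (divff (expf_neq0 2 (cexp_neq0 _))) invr1 !mulr1.
by rewrite -cexpMn; congr cexp; ring.
Qed.

(** An odd determinant is the preceding even one times a factor tending to 1. *)
Lemma det_ccvg :
  ccvg (fun n => \det (toeplitz_hankel (t_shift beta) n) *
                 cexp (- (det_exponent * lnc n%:R))) det_constant.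
Proof.
apply: ccvg_parity; first exact: det_even_ccvg.
have H1 := @ccvg_comp _ double _ _ leq_double_self det_ratio_ccvg1.
have H2 := ccvg_cexp (ccvgM (@ccvg_cst R det_exponent)
  (@ccvg_comp _ double _ _ leq_double_self ln_succ_ccvg0)).
rewrite mulr0 cexp0 in H2.
have := ccvgM det_even_ccvg (ccvgM H1 H2); rewrite !mulr1.
apply: ccvg_near; apply: nearW => n /=.
rewrite det_toeplitz_hankel_rec //.
have -> : cexp (- (det_exponent * lnc n.*2.+1%:R)) =
    cexp (- (det_exponent * lnc n.*2%:R)) *
    cexp (det_exponent * (lnc n.*2%:R - lnc n.*2.+1%:R)).
  by rewrite -cexpD; congr cexp; ring.
by ring.
Qed.

End Assembly.

Section Conclusion.
Variable R : realType.
Variable beta : R[i].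
Local Notation lnc x := ((ln x : R)%:C).

(** The powers of 2 pi cancel, and so do the exponentials of quadratic
    polynomials in beta against those left by the asymptotics. *)
Lemma det_constantE : det_constant beta =
  cpow (2 * pi) (beta / 2) * cpow 2 (3 * beta ^+ 2 / 2) * (barnesG (3 / 2))^-1 *
  barnesG (3 / 2 - beta) * barnesG (1 - beta) * barnesG (1 + beta).
Proof.
rewrite /barnesG.
have -> : 3 / 2 - 1 = 1 / 2 :> R[i] by field.
have -> : 3 / 2 - beta - 1 = 1 / 2 - beta by field.
have -> : 1 - beta - 1 = - beta by ring.
have -> : 1 + beta - 1 = beta by ring.
rewrite !barnesG1pE /cpow /det_constant; set L := lnc (2 * pi).
set x1 := cexp (- beta ^+ 2); set x2 := cexp (beta - _); set x3 := cexp (_ * lnc 2).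
set a0 := cexp (beta / 2 * L).
set a1 := cexp (1 / 2 / 2 * L); set b1 := cexp (- ((1 / 2 + 1) * _ / 2)).
set a2 := cexp ((1 / 2 - beta) / 2 * L); set b2 := cexp (- ((1 / 2 - beta + 1) * _ / 2)).
set a3 := cexp (- beta / 2 * L); set b3 := cexp (- ((- beta + 1) * _ / 2)).
set b4 := cexp (- ((beta + 1) * _ / 2)).
have e : x1 * x2 * (a1 * b1) = a0 * (a2 * b2) * (a3 * b3) * (a0 * b4).
  by rewrite -!cexpD; congr cexp; field.
have a10 : a1 != 0 by exact: cexp_neq0.
have b10 : b1 != 0 by exact: cexp_neq0.
have c10 := core_half_neq0 R.
move: (barnes_core (1 / 2)) (barnes_core (1 / 2 - beta)) (barnes_core beta)
  (barnes_core (- beta)) c10 => c1 c2 c3 c4 c10.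
have -> : x1 * (c3 * c4) * (c2 / c1) * x2 * x3 =
   x1 * x2 * (a1 * b1) * (c3 * c4 * c2 * x3) / (a1 * b1 * c1).
  clear e; clearbody x1 x2 x3 a1 b1; by field; rewrite a10 b10 c10.
rewrite e invfM; clearbody x3 a0 a1 a2 a3 b1 b2 b3 b4; clear e.
by field; rewrite a10 b10 c10.
Qed.

End Conclusion.

Theorem theorem6p3 (R : realType) (beta : R[i])
    (beta_nonint : forall m : int, beta <> m%:~R) :
  asymp_equiv (fun n : nat => \det (toeplitz_hankel (t_shift beta) n))
    (fun n : nat =>
       cpow n%:R (- (3 * beta ^+ 2 / 2) + beta / 2)
       * cpow (2 * pi) (beta / 2)
       * cpow 2 (3 * beta ^+ 2 / 2)
       * (barnesG (3 / 2))^-1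
       * barnesG (3 / 2 - beta)
       * barnesG (1 - beta)
       * barnesG (1 + beta))
  /\ (forall n : nat, (0 < n)%N ->
        \det (toeplitz_hankel (t_shift beta) n) = 0 <-> det_zeros n beta).
Proof.
split; last by move=> n _; exact: det_toeplitz_hankel_zeros.
pose c n := cpow n%:R (- (3 * beta ^+ 2 / 2) + beta / 2) * det_constant beta.
rewrite [X in asymp_equiv _ X](_ : _ = c); last first.
  by apply/funext => n; rewrite /c det_constantE !mulrA.
have [w0|/existsNP[j /not_implyP[j0 /negP]]] :=
    pselect (forall j, (0 < j)%N -> double_factor beta j.*2.+1 != 0).
- have C0 : det_constant beta != 0.
    rewrite /det_constant.
    move: (core_pos_neq0 beta_nonint) (core_neg_neq0 beta_nonint).
    move: (core_half_sub_neq0 w0) (core_half_neq0 R).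
    move: (barnes_core _) (barnes_core _) (barnes_core _) (barnes_core _) => c1 c2 c3 c4.
    move: (cexp_neq0 (- beta ^+ 2)) (cexp_neq0 (beta - beta ^+ 2 / 2)).
    move: (cexp_neq0 (3 * beta ^+ 2 / 2 * (ln 2)%:C)).
    move: (cexp _) (cexp _) (cexp _) => x1 x2 x3 h1 h2 h3 h4 h5 h6 h7.
    by rewrite !mulf_neq0 ?invr_eq0.
  have h := ccvgM (det_ccvg beta_nonint w0) (@ccvg_cst R (det_constant beta)^-1).
  rewrite divff // in h.
  exists (fun n => \det (toeplitz_hankel (t_shift beta) n) / c n - 1).
    have := ccvgB h (@ccvg_cst R 1); rewrite subrr; apply: ccvg_near.
    apply: nearW => n; rewrite /c /cpow (invfM (cexp _)) -cexpN -/(det_exponent beta).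
    by congr (_ - 1); rewrite -[LHS]mulrA.
  apply: nearW => n; rewrite addrC subrK mulrC divfK //.
  by rewrite mulf_neq0 ?cexp_neq0.
(* Resonance: both sides vanish as soon as n >= j + 2. *)
- move/negPn; rewrite double_factor_eq0 // => /eqP hj.
  have bj : beta = j%:R + 1 / 2.
    have two0 : (2 : R[i]) != 0 by rewrite pnatr_eq0.
    have e : j.*2.+1%:R = 2 * j%:R + 1 :> R[i] by rewrite -natr1 -mul2n natrM.
    by apply: (mulfI two0); rewrite hj e; field.
  exists (fun=> 0); first exact: ccvg_cst.
  exists j.+2 => // n /= jn.
  have -> : c n = 0.
    rewrite /c /det_constant /barnes_core; have -> : 1 / 2 - beta = - j%:R by rewrite bj; ring.
    by rewrite barnes_prod_eq0 // !(mul0r, mulr0).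
  rewrite mul0r; apply/(det_toeplitz_hankel_zeros beta_nonint); exists j => //=.
  by rewrite addn2.
Qed.
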